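(* There is a real constant $C>0$ such that for every $L^1(T)$-bounded martingale $f$ with respect to $(T_n)_{n\ge1}$ and every real $\lambda>0$, $$\lambda\, T P_{(f^{*}-\lambda e)^{+}}\,e\le C\|S(f)\|_1 .$$
   Context: $E$ is a Dedekind complete Riesz space with weak order unit $e>0$. A conditional expectation on $E$ is a strictly positive order-continuous linear projection $S:E\to E$ whose range $R(S)$ is a Dedekind complete Riesz subspace of $E$ and with $Se=e$. A filtration is a sequence $(T_i)_{i\ge1}$ of conditional expectations with $T_iT_j=T_jT_i=T_j$ for $j\le i$; put $T=T_1$. $E_u$ is the universal completion of $E$, with its $f$-algebra structure in which $e$ is the multiplicative unit. $E_s$ is the sup-completion of $E$: the unique Dedekind complete ordered cone with a largest element containing $E$ as the sub-cone equal to its group of invertible elements, such that $x=\sup\{g\in E:g\le x\}$ for $x\in E_s$; positive elements of $E_u$ are regarded as elements of $E_s$. For $x\in E_s$ positive, $Tx:=\sup_\alpha Tx_\alpha\in E_s$ for any increasing net $(x_\alpha)$ in $E^+$ with $x_\alpha\uparrow x$, and $\|x\|_1:=Tx$. $L^1(T)$ is the natural domain of $T$: the $x\in E_u$ with $T|x|\in E_u$; it is a Dedekind complete Riesz space with weak order unit $e$, and all $T_i$ extend to conditional expectations on it (same notation). A martingale is a sequence $f=(f_n)_{n\ge1}$ in $L^1(T)$ with $f_n\in R(T_n)$ and $T_if_j=f_i$ for $i\le j$. Put $\Delta f_1=f_1$, $\Delta f_n=f_n-f_{n-1}$ $(n\ge2)$. $f$ is $L^1(T)$-bounded if $\sup_nT|f_n|$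 exists in $L^1(T)$. The maximal function is $f^*=\sup_n|f_n|\in E_s$ and the square function is $S(f)=\sup_nS_n(f)\in E_s$ where $S_n(f)=\left(\sum_{k=1}^n(\Delta f_k)^2\right)^{1/2}$ (in the $f$-algebra $E_u$). For positive $x\in E$ (or $x\in E_s$), $P_x$ is the band projection of $E$ onto the band generated by $x$ (respectively by $\{g\in E:0\le g\le x\}$); for $x\in E_s$ positive, $(x-\lambda e)^+=\sup\{(g-\lambda e)^+:g\in E,\ 0\le g\le x\}$. *)

(* Defs.v *)
From HB Require Import structures.
From mathcomp Require Import all_boot all_order all_algebra.
From mathcomp Require Import all_classical all_reals.

Set Implicit Arguments.
Unset Strict Implicit.
Unset Printing Implicit Defensive.
Import Order.TTheory GRing.Theory Num.Theory.
Local Open Scope classical_set_scope.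
Local Open Scope ring_scope.

(* A lattice-ordered vector space. The lattice operations are fields because
   MathComp's hierarchy has no join of [Order.Lattice] with [GRing.Zmodule]
   below the totally ordered [Num.RealDomain]. *)
HB.mixin Record isRieszSpace (R : realType) E
    of Num.POrderedZmodule E & GRing.Lmodule R E := {
  rjoin : E -> E -> E ;
  rmeet : E -> E -> E ;
  rjoin_le : forall x y z : E, (rjoin x y <= z) = (x <= z) && (y <= z) ;
  rmeet_ge : forall x y z : E, (z <= rmeet x y) = (z <= x) && (z <= y) ;
  riesz_leD2r : forall x y z : E, x <= y -> x + z <= y + z ;
  riesz_scale_ge0 : forall (a : R) (x : E), 0 <= a -> 0 <= x -> 0 <= a *: x
}.

#[short(type="rieszSpaceType")]
HB.structure Definition RieszSpace (R : realType) :=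
  {E of Num.POrderedZmodule E & GRing.Lmodule R E & isRieszSpace R E}.

(* Commutativity is automatic for Archimedean f-algebras. *)
Record f_algebra (R : realType) (A : rieszSpaceType R)
    (mul : A -> A -> A) (one : A) : Prop := {
  falg_mulA : associative mul ;
  falg_mulC : commutative mul ;
  falg_mul1 : left_id one mul ;
  falg_linear : forall x, linear (mul x) ;
  falg_mul_ge0 : forall x y, 0 <= x -> 0 <= y -> 0 <= mul x y ;
  falg_disjoint : forall x y z,
    rmeet x y = 0 -> 0 <= z -> rmeet (mul x z) y = 0
}.

(* An ordered cone need not embed in a group, so it is not a [zmodType]; only the
   values of [cone_scale] at nonnegative scalars are meaningful. *)
HB.mixin Record isOrderedCone (R : realType) C of Order.POrder ring_display C := {
  cone_zero : C ;
  cone_add : C -> C -> C ;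
  cone_scale : R -> C -> C ;
  cone_addA : associative cone_add ;
  cone_addC : commutative cone_add ;
  cone_add0 : left_id cone_zero cone_add ;
  cone_scale0 : forall x, cone_scale 0 x = cone_zero ;
  cone_scale1 : forall x, cone_scale 1 x = x ;
  cone_scaleA : forall a b x, 0 <= a -> 0 <= b ->
    cone_scale a (cone_scale b x) = cone_scale (a * b) x ;
  cone_scaleDr : forall a x y, 0 <= a ->
    cone_scale a (cone_add x y) = cone_add (cone_scale a x) (cone_scale a y) ;
  cone_scaleDl : forall a b x, 0 <= a -> 0 <= b ->
    cone_scale (a + b) x = cone_add (cone_scale a x) (cone_scale b x) ;
  cone_le_add : forall x y z : C, x <= y -> cone_add x z <= cone_add y z ;
  cone_le_scale : forall a (x y : C), 0 <= a -> x <= y ->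
    cone_scale a x <= cone_scale a y
}.

#[short(type="orderedConeType")]
HB.structure Definition OrderedCone (R : realType) :=
  {C of Order.POrder ring_display C & isOrderedCone R C}.

Arguments cone_zero {R s}.

Definition dedekind_complete d (T : porderType d) :=
  forall A : set T, A !=set0 -> has_ubound A -> supremums A !=set0.

Section RieszSpaces.
Context {R : realType} {E : rieszSpaceType R}.
Implicit Types (x y z e : E) (A B D F : set E).

Definition rabs x : E := rjoin x (- x).
Definition rpos x : E := rjoin x 0.
Definition rneg x : E := rjoin (- x) 0.

(* Supremum of [A] relative to the subset [F] of [E]. *)
Definition is_sup_in F A s :=
  [/\ F s, ubound A s & forall t, F t -> ubound A t -> s <= t].

Definition linear_subspace F :=
  F 0 /\ forall (a : R) x y, F x -> F y -> F (a *: x + y).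

Definition riesz_subspace F :=
  linear_subspace F /\ forall x y, F x -> F y -> F (rjoin x y).

Definition dedekind_complete_in F :=
  forall A, A `<=` F -> A !=set0 -> (exists2 b, F b & ubound A b) ->
    exists s, is_sup_in F A s.

Definition solid F := forall x y, F y -> rabs x <= rabs y -> F x.

Definition band B :=
  [/\ linear_subspace B, solid B &
      forall A s, A `<=` B -> supremums A s -> B s].

Definition band_gen D : set E :=
  [set x | forall B, band B -> D `<=` B -> B x].

(* The component of [x] in [B] along the disjoint complement of [B]. *)
Definition band_proj B x : E :=
  xget 0 [set y | B y /\ forall z, B z -> rmeet (rabs (x - y)) (rabs z) = 0].

Definition weak_order_unit e := 0 < e /\ band_gen [set e] = [set: E].

Definition directed (I : Type) (leI : I -> I -> Prop) :=
  [/\ inhabited I, (forall i, leI i i),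
      (forall i j k, leI i j -> leI j k -> leI i k) &
      (forall i j, exists k, leI i k /\ leI j k)].

Definition order_cvg (I : Type) (leI : I -> I -> Prop) (x : I -> E) (l : E) :=
  exists y : I -> E,
    [/\ forall i j, leI i j -> y j <= y i,
        infimums (range y) 0 &
        forall i, rabs (x i - l) <= y i].

Definition order_continuous (S : E -> E) :=
  forall (I : Type) (leI : I -> I -> Prop) (x : I -> E) (l : E),
    directed leI -> order_cvg leI x l -> order_cvg leI (fun i => S (x i)) (S l).

Record conditional_expectation e (S : E -> E) : Prop := {
  ce_linear : linear S ;
  ce_strictly_positive : forall x, 0 < x -> 0 < S x ;
  ce_order_continuous : order_continuous S ;
  ce_projection : forall x, S (S x) = S x ;
  ce_range_subspace : riesz_subspace (range S) ;
  ce_range_complete : dedekind_complete_in (range S) ;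
  ce_unit : S e = e
}.

(* Sequences are indexed from 0: [T i], [f i] stand for T_{i+1}, f_{i+1}; in
   particular the operator T = T_1 is [T 0]. *)
Definition filtration e (T : nat -> E -> E) :=
  (forall i, conditional_expectation e (T i)) /\
  (forall i j x, (j <= i)%N -> T i (T j x) = T j x /\ T j (T i x) = T j x).

Definition laterally_complete :=
  forall D, D !=set0 -> (forall x, D x -> 0 <= x) ->
    (forall x y, D x -> D y -> x <> y -> rmeet x y = 0) ->
    supremums D !=set0.

End RieszSpaces.

Arguments laterally_complete {R} E.

Record universal_completion (R : realType) (E Eu : rieszSpaceType R)
    (ju : E -> Eu) : Prop := {
  uc_dedekind : dedekind_complete Eu ;
  uc_lateral : laterally_complete Eu ;
  uc_linear : linear ju ;
  uc_join : forall x y, ju (rjoin x y) = rjoin (ju x) (ju y) ;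
  uc_inj : injective ju ;
  uc_order_dense : forall u : Eu, 0 < u -> exists2 g : E, 0 < g & ju g <= u
}.

(* The fields [sc_minorized], [sc_sup], [sc_meet_sup] and [sc_add_sup] are the
   standard compatibility properties of the sup-completion; they make it unique.
   Without them other ordered cones satisfy the remaining fields,
   such as, for E = R, all nonempty lower sets (open and closed cuts), or the
   extended line with -oo added, and, for E = R^2, E with only a top added. *)
Record sup_completion (R : realType) (E : rieszSpaceType R)
    (Es : orderedConeType R) (js : E -> Es) : Prop := {
  sc_dedekind : dedekind_complete Es ;
  sc_top : exists t : Es, forall x, x <= t ;
  sc_zero : js 0 = cone_zero ;
  sc_add : forall x y, js (x + y) = cone_add (js x) (js y) ;
  sc_scale : forall a x, 0 <= a -> js (a *: x) = cone_scale a (js x) ;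
  sc_le : forall x y, (js x <= js y) = (x <= y) ;
  sc_invertible : forall x, range js x <-> exists y, cone_add x y = cone_zero ;
  sc_approx : forall x, supremums [set js g | g in [set g | js g <= x]] x ;
  sc_minorized : forall x, exists g, js g <= x ;
  sc_sup : forall (A : set E) s, supremums A s -> supremums (js @` A) (js s) ;
  sc_meet_sup : forall (A : set E) (s : Es) (h : E), A !=set0 ->
    supremums (js @` A) s -> js h <= s ->
    supremums [set rmeet h a | a in A] h ;
  sc_add_sup : forall (A : set Es) s x, A !=set0 ->
    supremums A s -> supremums [set cone_add x a | a in A] (cone_add x s)
}.

Section SupCompletion.
Context {R : realType} {E : rieszSpaceType R} {Es : orderedConeType R}.
Variable js : E -> Es.
Implicit Types (x : Es) (S T : E -> E).

Definition below x : set E := [set g | 0 <= g /\ js g <= x].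

(* Extension of a conditional expectation to the positive elements of [Es]:
   [below x] is an increasing net in the positive cone of [E] with supremum [x]. *)
Definition ce_sup S x : Es := supremum cone_zero [set js (S g) | g in below x].

Definition norm1 T x : Es := ce_sup T x.

Definition excess (e : E) (lambda : R) x : Es :=
  supremum cone_zero [set js (rpos (g - lambda *: e)) | g in below x].

Definition band_proj_sup x : E -> E := band_proj (band_gen (below x)).

End SupCompletion.

Section Martingales.
Context {R : realType} {E : rieszSpaceType R} {Eu : rieszSpaceType R}
        {Es : orderedConeType R}.
Variables (ju : E -> Eu) (js : E -> Es) (mul : Eu -> Eu -> Eu).
Implicit Types (u : Eu) (S : E -> E) (T : nat -> E -> E) (f : nat -> Eu).

(* The positive elements of [Eu] as elements of [Es]. *)
Definition eu_to_es u : Es :=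
  supremum cone_zero [set js g | g in [set g | 0 <= g /\ ju g <= u]].

Definition es_to_eu (x : Es) : Eu := xget 0 [set u | 0 <= u /\ eu_to_es u = x].

Definition L1 S : set Eu :=
  [set u | exists2 v, 0 <= v & eu_to_es v = ce_sup js S (eu_to_es (rabs u))].

(* Meaningful on [L1 (T 0)] when [S] is one of the [T i]. *)
Definition ce_L1 S u : Eu :=
  es_to_eu (ce_sup js S (eu_to_es (rpos u))) -
  es_to_eu (ce_sup js S (eu_to_es (rneg u))).

Record martingale T f : Prop := {
  mart_L1 : forall n, L1 (T 0%N) (f n) ;
  mart_adapted : forall n, exists2 u, L1 (T 0%N) u & ce_L1 (T n) u = f n ;
  mart_ce : forall i j, (i <= j)%N -> ce_L1 (T i) (f j) = f i
}.

Definition L1_bounded T f :=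
  exists s, is_sup_in (L1 (T 0%N)) (range (fun n => ce_L1 (T 0%N) (rabs (f n)))) s.

Definition mdiff f n : Eu := if n is m.+1 then f m.+1 - f m else f 0%N.

Definition falg_sqrt u : Eu := xget 0 [set v | 0 <= v /\ mul v v = u].

Definition maximal_function f : Es :=
  supremum cone_zero (range (fun n => eu_to_es (rabs (f n)))).

Definition square_partial f n : Eu :=
  falg_sqrt (\sum_(k < n.+1) mul (mdiff f k) (mdiff f k)).

Definition square_function f : Es :=
  supremum cone_zero (range (fun n => eu_to_es (square_partial f n))).

End Martingales.

(* Main.v *)
Require Import Defs.
From HB Require Import structures.
From mathcomp Require Import all_boot all_order all_algebra.
From mathcomp Require Import all_classical all_reals.
From mathcomp Require Import ring.

(** Why the inequality holds. Write [l] for the level, [S_n] for the square function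
    at time [n], and let [tau] be the first [n] with [|f_n| > l] or [S_n > l]. The
    transform [W_n] of [f] by the multipliers [2 f_k 1_{k < tau}], which are
    bounded and known at time [k], has expectation zero. Since
    [2 f_k (f_{k+1} - f_k) = f_{k+1}^2 - f_k^2 - (f_{k+1} - f_k)^2], it telescopes:
    [W_n = f_m^2 - S_m^2] with [m = min (tau, n)]. Comparing with the last time before
    [tau], when [|f|] and [S] are still at most [l], gives the pointwise bound
    [l^2 1_{tau <= n} <= 4 W_n + 14 l S_n] ([pathwise_bound]). Taking expectations,
    [l T 1_{tau <= n} <= 14 T S_n] ([weak_type_square]), and
    [f^* > l] is contained in the union of the events [tau <= n]. Stopping at [tau] replaces the
    division that occurs in pathwise proofs of Davis' inequality, so that only ring and
    lattice operations remain.

    In the universal completion, which is a unital f-algebra, events are idempotents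
    and the indicator [ind x] of [x > 0] is the component of the unit in the band of
    [x]. The pointwise bound is then proved on each of three complementary
    idempotents, where it is a sum of products of nonnegative elements. [E] sits in this algebra as an ideal containing the
    unit, and a conditional expectation acts on this ideal ([ideal_ce]). Three facts
    about it are needed. It commutes with multiplication by bounded elements of its
    range ([averaging]). It extends to nonnegative elements as a partial monotone
    limit ([is_ce]) whose values are measurable ([is_ce_measurable]). An element in the
    domain of [T_1] is also in the domain of [T_k] ([is_ce_tower]): a directed set that
    is unbounded in a universally complete space is infinite on a nonzero component,
    where [T_1] would be infinite as well.

    The passage to the sup-completion rests on one remark ([cut_ju], [cut_js]): for [D]
    a subset of [E] and [h] in [E], being below the supremum of [D] means, in either
    completion, that [h] is the supremum of the meets of [h] with elements of [D]. *)

Set Implicit Arguments.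
Unset Strict Implicit.
Unset Printing Implicit Defensive.
Import Order.TTheory GRing.Theory Num.Theory.
Local Open Scope classical_set_scope.
Local Open Scope ring_scope.

(** * Riesz spaces *)

Section RieszBasics.
Context {R : realType} {E : rieszSpaceType R}.
Implicit Types (x y z : E) (A : set E).

Lemma rleD2r z x y : (x + z <= y + z) = (x <= y).
Proof.
apply/idP/idP => [h|]; last exact: riesz_leD2r.
by have := riesz_leD2r _ _ (- z) h; rewrite !addrK.
Qed.

Lemma rleD2l z x y : (z + x <= z + y) = (x <= y).
Proof. by rewrite ![z + _]addrC rleD2r. Qed.

Lemma rsub_ge0 x y : (0 <= y - x) = (x <= y).
Proof. by rewrite -(rleD2r x 0) add0r subrK. Qed.

Lemma rleD x y z t : x <= y -> z <= t -> x + z <= y + t.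
Proof. by move=> xy zt; apply: (le_trans (y := y + z)); rewrite ?rleD2r ?rleD2l. Qed.

Lemma raddr_ge0 x y : 0 <= x -> 0 <= y -> 0 <= x + y.
Proof. by move=> x0 y0; rewrite -[0]addr0 rleD. Qed.

Lemma rleN2 x y : (- x <= - y) = (y <= x).
Proof. by rewrite -(rleD2r (x + y) (- x)) addKr addrCA addNr addr0. Qed.

Lemma rmuln_ge0 x n : 0 <= x -> 0 <= x *+ n.
Proof. by move=> x0; elim: n => // n IH; rewrite mulrS raddr_ge0. Qed.

Lemma rmuln_le x y n : x <= y -> x *+ n <= y *+ n.
Proof. by move=> xy; elim: n => // n IH; rewrite !mulrS rleD. Qed.

Lemma rmuln_le2 x m n : 0 <= x -> (m <= n)%N -> x *+ m <= x *+ n.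
Proof.
move=> x0 mn; rewrite -(subnKC mn) mulrnDr -{1}[x *+ m]addr0 rleD2l.
exact: rmuln_ge0.
Qed.

Lemma rle_subr x y z : (x <= y - z) = (x + z <= y).
Proof. by rewrite -(rleD2r z x) subrK. Qed.

Lemma rle_subl x y z : (x - z <= y) = (x <= y + z).
Proof. by rewrite -(rleD2r z (x - z)) subrK. Qed.

Lemma rscale_le (a : R) x y : 0 <= a -> x <= y -> a *: x <= a *: y.
Proof.
by move=> a0 xy; rewrite -rsub_ge0 -scalerBr riesz_scale_ge0 // rsub_ge0.
Qed.

Lemma rscale_le2 (a b : R) x : a <= b -> 0 <= x -> a *: x <= b *: x.
Proof.
by move=> ab x0; rewrite -rsub_ge0 -scalerBl riesz_scale_ge0 // subr_ge0.
Qed.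

Lemma rscale_leP (a : R) x y : 0 < a -> (a *: x <= a *: y) = (x <= y).
Proof.
move=> a0; apply/idP/idP => [h|]; last exact/rscale_le/ltW.
have /(rscale_le (ltW (_ : 0 < a^-1))) := h; rewrite invr_gt0 => /(_ a0).
by rewrite !scalerA mulVf ?gt_eqF // !scale1r.
Qed.

Lemma rjoin_ub x y : x <= rjoin x y /\ y <= rjoin x y.
Proof. by apply/andP; rewrite -rjoin_le. Qed.

Lemma rmeet_lb x y : rmeet x y <= x /\ rmeet x y <= y.
Proof. by apply/andP; rewrite -rmeet_ge. Qed.

Lemma rjoin_lel x y : x <= rjoin x y. Proof. by case: (rjoin_ub x y). Qed.
Lemma rjoin_ler x y : y <= rjoin x y. Proof. by case: (rjoin_ub x y). Qed.
Lemma rmeet_lel x y : rmeet x y <= x. Proof. by case: (rmeet_lb x y). Qed.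
Lemma rmeet_ler x y : rmeet x y <= y. Proof. by case: (rmeet_lb x y). Qed.

Lemma rjoin_eq x y z : (forall t, (z <= t) = (x <= t) && (y <= t)) -> rjoin x y = z.
Proof.
move=> h; apply/le_anti; rewrite rjoin_le -h lexx h /=.
by rewrite rjoin_lel rjoin_ler.
Qed.

Lemma rmeet_eq x y z : (forall t, (t <= z) = (t <= x) && (t <= y)) -> rmeet x y = z.
Proof.
move=> h; apply/le_anti; rewrite rmeet_ge -h lexx h /=.
by rewrite rmeet_lel rmeet_ler.
Qed.

Lemma rjoinC x y : rjoin x y = rjoin y x.
Proof. by apply: rjoin_eq => t; rewrite rjoin_le andbC. Qed.

Lemma rmeetC x y : rmeet x y = rmeet y x.
Proof. by apply: rmeet_eq => t; rewrite rmeet_ge andbC. Qed.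

Lemma rmeet_l x y : x <= y -> rmeet x y = x.
Proof.
move=> xy; apply: rmeet_eq => t; apply/idP/andP => [tx|[] //].
by split=> //; exact: le_trans xy.
Qed.

Lemma rjoinN x y : rjoin (- x) (- y) = - rmeet x y.
Proof. by apply: rjoin_eq => t; rewrite -!(rleN2 t) !opprK -rmeet_ge -rleN2 opprK. Qed.

Lemma rjoinDr x y z : rjoin x y + z = rjoin (x + z) (y + z).
Proof. by apply/esym/rjoin_eq => t; rewrite -!rle_subr rjoin_le. Qed.

Lemma rmeetDr x y z : rmeet x y + z = rmeet (x + z) (y + z).
Proof. by apply/esym/rmeet_eq => t; rewrite -!rle_subl rmeet_ge. Qed.

Lemma rmeet_le x y z t : x <= z -> y <= t -> rmeet x y <= rmeet z t.
Proof.
move=> xz yt; rewrite rmeet_ge (le_trans (rmeet_lel x y) xz).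
exact: le_trans (rmeet_ler x y) yt.
Qed.

Lemma rmeet_ge0 x y : 0 <= x -> 0 <= y -> 0 <= rmeet x y.
Proof. by move=> x0 y0; rewrite rmeet_ge x0. Qed.

Lemma rmeetE x y : rmeet x y = x - rpos (x - y).
Proof.
rewrite -[LHS]opprK -rjoinN -[RHS]opprK opprB; congr (- _).
by rewrite /rpos rjoinDr addrAC subrr !add0r rjoinC.
Qed.

Lemma rpos_ge0 x : 0 <= rpos x. Proof. exact: rjoin_ler. Qed.
Lemma rneg_ge0 x : 0 <= rneg x. Proof. exact: rjoin_ler. Qed.
Lemma rpos_ge x : x <= rpos x. Proof. exact: rjoin_lel. Qed.

Lemma rpos_le x y : 0 <= y -> (rpos x <= y) = (x <= y).
Proof. by move=> y0; rewrite rjoin_le y0 andbT. Qed.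

Lemma rpos_mono x y : x <= y -> rpos x <= rpos y.
Proof. by move=> xy; rewrite rpos_le ?rpos_ge0 // (le_trans xy) ?rpos_ge. Qed.

Lemma rpos_id x : 0 <= x -> rpos x = x.
Proof. by move=> x0; apply/le_anti; rewrite rpos_ge rpos_le // lexx. Qed.

Lemma rpos_eq0 x : (rpos x = 0) <-> (x <= 0).
Proof.
split=> [<-|x0]; first exact: rpos_ge.
by apply/le_anti; rewrite rpos_ge0 rpos_le // x0.
Qed.

Lemma rneg_def x : rneg x = rpos (- x). Proof. by []. Qed.

Lemma rposE x : rpos x - rneg x = x.
Proof.
have -> : rneg x = rpos x - x by rewrite /rpos rjoinDr subrr sub0r rjoinC.
by rewrite opprB addrC subrK.
Qed.

Lemma rpos_rneg x : rmeet (rpos x) (rneg x) = 0.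
Proof.
apply/(addIr (- rneg x)); rewrite rmeetDr subrr rposE add0r.
by rewrite rneg_def /rpos -[in rjoin _ 0]oppr0 rjoinN opprK.
Qed.

Lemma rabs_le x y : (rabs x <= y) = (x <= y) && (- x <= y).
Proof. by rewrite rjoin_le. Qed.

Lemma rabs_ge x : x <= rabs x. Proof. exact: rjoin_lel. Qed.
Lemma rabs_geN x : - x <= rabs x. Proof. exact: rjoin_ler. Qed.

Lemma rabs_ge0 x : 0 <= rabs x.
Proof.
rewrite -(rscale_leP _ _ (ltr0n R 2)) scaler0 scaler_nat mulr2n.
by rewrite -[0](subrr x) rleD ?rabs_ge ?rabs_geN.
Qed.

Lemma rabsN x : rabs (- x) = rabs x.
Proof. by rewrite /rabs opprK rjoinC. Qed.

Lemma rabs_id x : 0 <= x -> rabs x = x.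
Proof.
move=> x0; apply/le_anti; rewrite rabs_ge rabs_le lexx /=.
by rewrite (le_trans _ x0) // -oppr0 rleN2.
Qed.

Lemma rabsE x : rabs x = rpos x + rneg x.
Proof.
apply/le_anti/andP; split.
  rewrite rabs_le; apply/andP; split.
    by rewrite -[x in x <= _]addr0 rleD ?rpos_ge ?rneg_ge0.
  by rewrite -[- x]add0r rleD ?rpos_ge0 // rneg_def rpos_ge.
have -> : rpos x + rneg x = 2 *: rpos x - x.
  have h : rpos x - x = rneg x by rewrite -{2}(rposE x) opprB addrC subrK.
  by rewrite scaler_nat mulr2n -addrA h.
rewrite rle_subl.
have h2 : 0 < (2 : R)^-1 by rewrite invr_gt0 ltr0n.
have h2' : (0 : R) < 2 by rewrite ltr0n.
rewrite -(rscale_leP _ _ h2) scalerA mulVf ?gt_eqF // scale1r.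
have hx (y : E) : (y <= 2^-1 *: (rabs x + x)) = (y + y <= rabs x + x).
  by rewrite -(rscale_leP y _ h2') scalerA divff ?gt_eqF // scale1r scaler_nat mulr2n.
rewrite rjoin_le !hx rleD2r rabs_ge addr0 /=.
by rewrite -rle_subl sub0r rabs_geN.
Qed.

Lemma rabsD x y : rabs (x + y) <= rabs x + rabs y.
Proof. by rewrite rabs_le opprD !rleD ?rabs_ge ?rabs_geN. Qed.

Lemma rabs0_eq x : rabs x <= 0 -> x = 0.
Proof.
rewrite rabs_le => /andP[x0 nx0]; apply/le_anti.
by rewrite x0 -rleN2 oppr0.
Qed.

End RieszBasics.

Section RieszSuprema.
Context {R : realType} {E : rieszSpaceType R}.
Implicit Types (x y z : E) (A : set E).

Lemma sup_uniq A x y : supremums A x -> supremums A y -> x = y.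
Proof. by move=> [ux lx] [uy ly]; apply/le_anti; rewrite lx // ly. Qed.

Lemma supremumE d (T : porderType d) (x0 : T) (A : set T) s :
  A !=set0 -> supremums A s -> supremum x0 A = s.
Proof.
move=> [a Aa] As; rewrite /supremum; case: eqP => [A0|_]; first by move: Aa; rewrite A0.
have [u l] := xgetPex x0 (ex_intro _ s As).
apply/le_anti/andP; split; [exact: l As.1 | exact: As.2 u].
Qed.

(** A supremum [s] of the multiples of [x] would also be bounded by [s - x]. *)
Lemma archimedean x y : dedekind_complete E -> (forall n, x *+ n <= y) -> x <= 0.
Proof.
move=> dc xy; have [||s [us ls]] := dc (range (fun n => x *+ n)).
- by exists (x *+ 0), 0%N.
- by exists y => _ [n _ <-].
have : s <= s - x.
  by apply: ls => _ [n _ <-]; rewrite rle_subr -mulrSr; apply: us; exists n.+1.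
by rewrite rle_subr -{2}[s]addr0 rleD2l.
Qed.

(** Infinite distributivity: [rmeet a t = a - rpos (a - t)], together with [a <= s],
    turns a bound on the meets into a bound on [a]. *)
Lemma sup_meet A s t :
  supremums A s -> supremums [set rmeet t a | a in A] (rmeet t s).
Proof.
move=> [us ls]; split=> [_ [a Aa <-]|z uz]; first exact: rmeet_le (us _ Aa).
rewrite rmeetC rmeetE rle_subl; apply: ls => a Aa.
have := uz _ (ex_intro2 _ _ a Aa erefl).
rewrite rmeetC rmeetE rle_subl => /le_trans; apply.
by rewrite rleD2l rpos_mono // rleD2r us.
Qed.

Lemma rmeet_pos x y : 0 <= y -> rmeet (rpos x) y = rpos (rmeet x y).
Proof.
move=> y0; have xs : supremums [set x; 0] (rpos x).
  split=> [_ [->|->]|z uz]; rewrite ?rpos_ge ?rpos_ge0 //.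
  by rewrite rjoin_le !uz //; [right | left].
rewrite [RHS](_ : _ = rjoin (rmeet y x) 0); last by rewrite rmeetC.
have [u l] := sup_meet y xs; rewrite rmeetC; apply/le_anti/andP; split.
  apply: l => _ [_ [->|->] <-]; first exact: rjoin_lel.
  by rewrite [rmeet y 0]rmeetC rmeet_l // rjoin_ler.
rewrite rjoin_le; apply/andP; split; first by apply: u; exists x => //; left.
by apply: u; exists 0; [right | rewrite rmeetC rmeet_l].
Qed.

Lemma sup_scale A s (a : R) : 0 < a ->
  supremums A s -> supremums [set a *: x | x in A] (a *: s).
Proof.
move=> a0 [us ls]; split=> [_ [x Ax <-]|z uz]; first by rewrite rscale_le ?us // ltW.
have ai : 0 < a^-1 by rewrite invr_gt0.
rewrite -(rscale_leP _ _ ai) scalerA mulVf ?gt_eqF // scale1r.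
apply: ls => x Ax; rewrite -(rscale_leP _ _ a0) scalerA divff ?gt_eqF // scale1r.
by apply: uz; exists x.
Qed.

End RieszSuprema.

(** * Archimedean f-algebras *)

Section FAlgebraRing.
Context {R : realType} {A : rieszSpaceType R} {mul : A -> A -> A} {one : A}.

Fact f_algebra_mulDl (H : f_algebra mul one) : left_distributive mul +%R.
Proof.
move=> x y z; rewrite !(falg_mulC H _ z).
by have := falg_linear H z 1 x y; rewrite !scale1r.
Qed.

(** A copy of the carrier on which the product of the f-algebra is the ring
    multiplication, so that ring notations and the [ring] tactic apply. *)
Definition falg (H : f_algebra mul one) : Type := A.

HB.instance Definition _ H := RieszSpace.on (falg H).
HB.instance Definition _ H := GRing.Zmodule_isComPzRing.Build (falg H)
  (falg_mulA H) (falg_mulC H) (falg_mul1 H) (f_algebra_mulDl H).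

End FAlgebraRing.

Section FAlgebra.
Context {R : realType} {A : rieszSpaceType R} {mul : A -> A -> A} {one : A}.
Variable H : f_algebra mul one.
Notation U := (falg H).
Implicit Types (x y z p q u v w c d : U).

Lemma fscaleAl (a : R) x y : a *: (x * y) = (a *: x) * y.
Proof.
rewrite [RHS]mulrC [in LHS]mulrC; have := falg_linear H y a x 0.
by rewrite !addr0 -[mul]/(@GRing.mul U) mulr0 addr0.
Qed.

Lemma fscaleE (a : R) x : a *: x = (a *: (1 : U)) * x.
Proof. by rewrite -fscaleAl mul1r. Qed.

Lemma fmul_ge0 x y : 0 <= x -> 0 <= y -> 0 <= x * y.
Proof. exact: falg_mul_ge0 H x y. Qed.

Lemma fmul_le2l z x y : 0 <= z -> x <= y -> z * x <= z * y.
Proof. by move=> z0 xy; rewrite -rsub_ge0 -mulrBr fmul_ge0 // rsub_ge0. Qed.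

Lemma fmul_le2r z x y : 0 <= z -> x <= y -> x * z <= y * z.
Proof. by rewrite ![_ * z]mulrC; exact: fmul_le2l. Qed.

Lemma fmul_le x y z t : 0 <= x -> 0 <= z -> x <= y -> z <= t -> x * z <= y * t.
Proof.
move=> x0 z0 xy zt; apply: le_trans (fmul_le2l x0 zt) _.
exact: fmul_le2r (le_trans z0 zt) xy.
Qed.

Lemma disj_mul0 x y : 0 <= x -> 0 <= y -> rmeet x y = 0 -> x * y = 0.
Proof.
move=> x0 y0 xy; have := falg_disjoint H xy y0; rewrite rmeetC => /(falg_disjoint H)/(_ x0).
rewrite -[mul]/(@GRing.mul U) (mulrC y) => <-.
by apply/esym/(@rmeet_eq _ U) => t; rewrite andbb.
Qed.

Lemma rpos_rneg_mul0 x : rpos x * rneg x = 0.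
Proof. by apply: disj_mul0 (rpos_rneg x); rewrite ?rpos_ge0 ?rneg_ge0. Qed.

Lemma fmul_parts x y : x * y = rpos x * rpos y + rneg x * rneg y
                      - (rpos x * rneg y + rneg x * rpos y).
Proof. by rewrite -{1}(rposE x) -{1}(rposE y); ring. Qed.

Lemma rabs_sqr x : rabs x * rabs x = x * x.
Proof.
rewrite rabsE [RHS]fmul_parts; have e := rpos_rneg_mul0 x.
transitivity (rpos x * rpos x + rneg x * rneg x + 2 * (rpos x * rneg x)); first by ring.
by rewrite [rneg x * rpos x]mulrC e; ring.
Qed.

Lemma fsqr_ge0 x : 0 <= x * x.
Proof. by rewrite -rabs_sqr fmul_ge0 // rabs_ge0. Qed.

Lemma fone_ge0 : 0 <= 1 :> U.
Proof. by rewrite -[1]mul1r fsqr_ge0. Qed.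

Lemma rabs_mul_ge x y : - (rabs x * rabs y) <= x * y.
Proof.
rewrite -rsub_ge0 opprK !rabsE [X in X + _]fmul_parts.
have -> : forall a b c d : U, a * b + c * d - (a * d + c * b) + (a + c) * (b + d)
            = (a * b + c * d) + (a * b + c * d) by move=> *; ring.
by rewrite !raddr_ge0 ?fmul_ge0 ?rpos_ge0 ?rneg_ge0.
Qed.

Lemma rabs_mul_le x y : rabs (x * y) <= rabs x * rabs y.
Proof.
have hN z t : - z <= t -> - t <= z :> U by rewrite -[z in _ <= z]opprK rleN2.
rewrite rabs_le (hN _ _ (rabs_mul_ge x y)) andbT.
by have := hN _ _ (rabs_mul_ge (- x) y); rewrite mulNr opprK rabsN.
Qed.

Lemma rpos_disj x y : rmeet x y = 0 -> rpos (x - y) = x :> U.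
Proof. by rewrite rmeetE => /eqP; rewrite subr_eq0 => /eqP <-. Qed.

(** Multiplication by [y >= 0] keeps [rpos x] and [rneg x] disjoint, and a
    difference of disjoint elements determines its positive part. *)
Lemma rpos_mul x y : 0 <= y -> rpos (x * y) = rpos x * y.
Proof.
move=> y0; rewrite -{1}(rposE x) mulrBl; apply: rpos_disj.
apply: (falg_disjoint H) => //; rewrite rmeetC.
by apply: (falg_disjoint H) => //; rewrite rmeetC rpos_rneg.
Qed.

Lemma rmeet_mul x y z : 0 <= z -> rmeet x y * z = rmeet (x * z) (y * z).
Proof. by move=> z0; rewrite !rmeetE -mulrBl rpos_mul // mulrBl. Qed.

Lemma idem_ge0 p : p * p = p -> 0 <= p.
Proof. by move=> <-; exact: fsqr_ge0. Qed.

Lemma idemC p : p * p = p -> (1 - p) * (1 - p) = 1 - p.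
Proof.
move=> pp; have -> : (1 - p) * (1 - p) = 1 - p + (p * p - p) by ring.
by rewrite pp subrr addr0.
Qed.

Lemma idem_le1 p : p * p = p -> p <= 1.
Proof. by move=> /idemC/idem_ge0; rewrite rsub_ge0. Qed.

Lemma idemM p q : p * p = p -> q * q = q -> (p * q) * (p * q) = p * q.
Proof. by move=> pp qq; rewrite mulrACA pp qq. Qed.

Hypothesis dc : dedekind_complete U.

(** With [y] the [n]-fold multiple of [rabs x], [y * y = 0] and
    [(y - 1) * (y - 1) >= 0] give [2 y <= 1], for every [n]. *)
Lemma fsqr_eq0 x : x * x = 0 -> x = 0.
Proof.
move=> xx; apply: rabs0_eq; apply: (archimedean (y := (1 : U))) => // n.
set y := rabs x *+ n; have y0 : 0 <= y by rewrite rmuln_ge0 ?rabs_ge0.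
have yy : y * y = 0 by rewrite /y mulrnAl mulrnAr rabs_sqr xx !mul0rn.
rewrite (le_trans (y := y + y)) //; first by rewrite -{1}[y]addr0 rleD2l.
have := fsqr_ge0 (y - 1).
have -> : (y - 1) * (y - 1) = y * y + (1 - (y + y)) by ring.
by rewrite yy add0r rsub_ge0.
Qed.

Lemma mul0_disj x y : 0 <= x -> 0 <= y -> x * y = 0 -> rmeet x y = 0.
Proof.
move=> x0 y0 xy; apply: fsqr_eq0; apply/le_anti; rewrite fsqr_ge0 andbT -xy.
by rewrite fmul_le ?rmeet_ge0 ?rmeet_lel ?rmeet_ler.
Qed.

Lemma le_sqr (a b : U) : 0 <= a -> 0 <= b -> a * a <= b * b -> a <= b.
Proof.
move=> a0 b0 ab; pose c : U := rpos (a - b).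
have c0 : c * (a + b) = 0.
  rewrite -rpos_mul ?raddr_ge0 //; apply/rpos_eq0.
  have -> : (a - b) * (a + b) = a * a - b * b by ring.
  by rewrite rle_subl add0r.
suff /rpos_eq0 : rpos (a - b) = 0 by rewrite rle_subl add0r.
apply: fsqr_eq0; apply/le_anti; rewrite fsqr_ge0 andbT -c0 fmul_le2l ?rpos_ge0 //.
rewrite rpos_le ?raddr_ge0 // rle_subl -addrA -{1}[a]addr0 rleD2l.
by rewrite raddr_ge0.
Qed.

(** If [z] bounds all [y * d] then [y * v - z <= y * (v - d) <= K (v - d)], so
    [v - (y * v - z) / K] also bounds [D]. *)
Lemma sup_mul_bounded (D : set U) v y (K : R) : 0 < K -> 0 <= y -> y <= K *: (1 : U) ->
  supremums D v -> supremums [set y * d | d in D] (y * v).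
Proof.
move=> K0 y0 yK [uv lv]; split=> [_ [d Dd <-]|z uz]; first by rewrite fmul_le2l ?uv.
have Ki : 0 < K^-1 by rewrite invr_gt0.
suff : v <= v - K^-1 *: (y * v - z).
  rewrite -{1}[v]addr0 rleD2l -{1}oppr0 rleN2 -(rscale_leP _ _ K0) scalerA divff ?gt_eqF //.
  by rewrite scale1r scaler0 rle_subl add0r.
apply: lv => d Dd; rewrite rle_subr addrC -rle_subr.
rewrite -(rscale_leP _ _ K0) scalerA divff ?gt_eqF // scale1r.
apply: (le_trans (y := y * v - y * d)).
  by rewrite rleD2l rleN2 uz //; exists d.
by rewrite -mulrBr fscaleE fmul_le2r // rsub_ge0 uv.
Qed.

(** ** Indicators *)

(** The indicator of the set where [x > 0]: the component of the unit in the
    band generated by [rpos x]. *)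
Definition ind x : U := supremum 0 (range (fun n => rmeet (rpos x *+ n) 1)).

Lemma ind_sup x : supremums (range (fun n => rmeet (rpos x *+ n) 1)) (ind x).
Proof.
set B := range _; have B0 : B !=set0 by exists (rmeet (rpos x *+ 0) 1), 0%N.
have [|s Bs] := dc B0; first by exists 1 => _ [n _ <-]; exact: rmeet_ler.
by rewrite /ind (supremumE _ B0 Bs).
Qed.

Lemma ind_ge x n : rmeet (rpos x *+ n) 1 <= ind x.
Proof. by apply: (ind_sup x).1; exists n. Qed.

Lemma ind_ge0 x : 0 <= ind x.
Proof. by apply: le_trans (ind_ge x 0); rewrite mulr0n rmeet_ge lexx fone_ge0. Qed.

Lemma ind_le1 x : ind x <= 1.
Proof. by apply: (ind_sup x).2 => _ [n _ <-]; exact: rmeet_ler. Qed.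

(** Doubling the approximants of [ind x] and cutting at [1] again gives
    approximants, hence [rmeet (2 * ind x) 1 <= ind x]; that is disjointness. *)
Lemma ind_disjC x : rmeet (ind x) (1 - ind x) = 0.
Proof.
apply/le_anti; rewrite rmeet_ge0 ?ind_ge0 ?rsub_ge0 ?ind_le1 // andbT.
rewrite -(rleD2r (ind x)) rmeetDr add0r subrK rmeetC.
have -> : ind x + ind x = (2 : R) *: ind x by rewrite scaler_nat mulr2n.
apply: (sup_meet (1 : U) (sup_scale (ltr0n R 2) (ind_sup x))).2.
move=> _ [_ [_ [n _ <-] <-] <-]; apply: le_trans (ind_ge x (n + n)).
rewrite rmeetC rmeet_ge rmeet_ler andbT.
apply: le_trans (rmeet_lel _ _) _; rewrite scaler_nat mulr2n mulrnDr.
by rewrite rleD ?rmeet_lel.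
Qed.

Lemma ind_idem x : ind x * ind x = ind x.
Proof.
have /disj_mul0 := ind_disjC x; rewrite ind_ge0 rsub_ge0 ind_le1 => /(_ isT isT).
by rewrite mulrBr mulr1 => /eqP; rewrite subr_eq0 => /eqP.
Qed.

Lemma indC_idem x : (1 - ind x) * (1 - ind x) = 1 - ind x.
Proof. exact: idemC (ind_idem x). Qed.

Lemma indC_ge0 x : 0 <= 1 - ind x.
Proof. by rewrite rsub_ge0 ind_le1. Qed.

Lemma ind_rpos x : ind x * rpos x = rpos x.
Proof.
suff /disj_mul0 : rmeet (rpos x) (1 - ind x) = 0.
  rewrite rpos_ge0 rsub_ge0 ind_le1 => /(_ isT isT).
  by rewrite mulrBr mulr1 => /eqP; rewrite subr_eq0 mulrC => /eqP.
apply/le_anti; rewrite rmeet_ge0 ?rpos_ge0 ?rsub_ge0 ?ind_le1 // andbT -(ind_disjC x).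
rewrite rmeet_ge rmeet_ler andbT; apply: le_trans (ind_ge x 1); rewrite mulr1n.
rewrite rmeet_le // -rsub_ge0 opprB addrC subrK; exact: ind_ge0.
Qed.

Lemma ind_disj z x : 0 <= z -> z * rpos x = 0 -> z * ind x = 0.
Proof.
move=> z0 zx; apply: disj_mul0 => //; first exact: ind_ge0.
apply/le_anti; rewrite rmeet_ge0 ?ind_ge0 // andbT.
apply: (sup_meet z (ind_sup x)).2 => _ [_ [n _ <-] <-].
suff <- : rmeet z (rpos x *+ n) = 0 by rewrite rmeet_le ?rmeet_lel.
by apply: mul0_disj; rewrite ?rmuln_ge0 ?rpos_ge0 // mulrnAr zx mul0rn.
Qed.

Lemma ind_mul x : ind x * x = rpos x.
Proof.
rewrite -{2}(rposE x) mulrBr ind_rpos [ind x * _]mulrC ind_disj ?rneg_ge0 ?subr0 //.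
by rewrite mulrC rpos_rneg_mul0.
Qed.

Lemma ind_sub_ge x y : ind (x - y) * y <= ind (x - y) * x.
Proof. by rewrite -rsub_ge0 -mulrBr ind_mul rpos_ge0. Qed.

Lemma indC_sub_le x y : (1 - ind (x - y)) * x <= (1 - ind (x - y)) * y.
Proof.
rewrite -rsub_ge0 -mulrBr -[y - x]opprB mulrN mulrBl mul1r ind_mul opprB.
by rewrite rsub_ge0 rpos_ge.
Qed.

Lemma indC_rpos x : (1 - ind x) * rpos x = 0.
Proof. by rewrite mulrBl mul1r ind_rpos subrr. Qed.

(** Used to compute indicators of products, where the defining supremum is
    inconvenient. *)
Lemma ind_uniq p x : p * p = p -> p * rpos x = rpos x ->
  (forall z, 0 <= z -> z * rpos x = 0 -> z * p = 0) -> ind x = p.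
Proof.
move=> pp px px0.
have e1 : (1 - p) * ind x = 0.
  apply: ind_disj; first exact/idem_ge0/idemC.
  by rewrite mulrBl mul1r px subrr.
have e2 := px0 _ (indC_ge0 x) (indC_rpos x).
apply/eqP; rewrite -subr_eq0; apply/eqP; rewrite -{1}[ind x]mul1r -{1}[p]mul1r.
have -> : 1 * ind x - 1 * p = (1 - p) * ind x - (1 - ind x) * p by ring.
by rewrite e1 e2 subrr.
Qed.

(** The indicators of [v <= n] exhaust the unit, since [n x <= x v]
    for every [x] carried by the set where [v > n]. *)
Lemma exhaust_le v x : 0 <= x ->
  (forall n, (1 - ind (v - n%:R)) * x = 0) -> x = 0.
Proof.
move=> x0 vx; apply/le_anti; rewrite x0 andbT.
apply: (archimedean (y := x * v)) => // n.
have xn : ind (v - n%:R) * x = x.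
  by have /eqP := vx n; rewrite mulrBl mul1r subr_eq0 => /eqP.
have /(fmul_le2r x0) := ind_sub_ge v n%:R.
by rewrite mulrAC xn mulrAC xn mulr_natr.
Qed.

Lemma exhaust_rpos (I : Type) (c : I -> U) x : (forall i, 0 <= c i) ->
  (forall x, 0 <= x -> (forall i, c i * x = 0) -> x = 0) ->
  (forall i, c i * x <= 0) -> x <= 0.
Proof.
move=> c0 cx cxi; apply/rpos_eq0/cx; first exact: rpos_ge0.
by move=> i; rewrite mulrC -rpos_mul // mulrC; apply/rpos_eq0.
Qed.

(** An inequality may be tested on each of the sets where [v <= n]; this reduces
    unbounded multipliers to bounded ones. *)
Lemma le_local v x y :
  (forall n, (1 - ind (v - n%:R)) * x <= (1 - ind (v - n%:R)) * y) -> x <= y.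
Proof.
move=> xy; rewrite -[y]add0r -rle_subl.
apply: (exhaust_rpos (c := fun n => 1 - ind (v - n%:R))) => [n|z z0|n].
- exact: indC_ge0.
- exact: exhaust_le.
- by rewrite mulrBr rle_subl add0r.
Qed.

Lemma fnat_ge0 n : 0 <= n%:R :> U.
Proof. by rewrite rmuln_ge0 ?fone_ge0. Qed.

Lemma indC_nat_le v n : (1 - ind (v - n%:R)) * v <= n.+1%:R.
Proof.
apply: le_trans (indC_sub_le _ _) _; apply: (le_trans (y := n%:R : U)).
  rewrite -[X in _ <= X]mul1r fmul_le2r ?fnat_ge0 //.
  by rewrite rle_subl -{1}[1]addr0 rleD2l ind_ge0.
by rewrite -[n.+1]addn1 mulrnDr -{1}[n%:R]addr0 rleD2l fone_ge0.
Qed.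

Lemma sup_mul (D : set U) v y : 0 <= y ->
  supremums D v -> supremums [set y * d | d in D] (y * v).
Proof.
move=> y0 Dv; split=> [_ [d Dd <-]|z uz]; first by rewrite fmul_le2l ?Dv.1.
apply: (le_local (v := y)) => n; set c := 1 - ind _; rewrite mulrA.
have c0 : 0 <= c := indC_ge0 _.
have cy : c * y <= (n.+1%:R : R) *: (1 : U) by rewrite scaler_nat indC_nat_le.
apply: (sup_mul_bounded _ _ cy Dv).2; rewrite ?ltr0n ?fmul_ge0 //.
by move=> _ [d Dd <-]; rewrite -mulrA fmul_le2l // uz //; exists d.
Qed.

Lemma sup_truncation v : 0 <= v ->
  supremums (range (fun n => rmeet v (n%:R : U))) v.
Proof.
move=> v0; split=> [_ [n _ <-]|z uz]; first exact: rmeet_lel.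
apply: (le_local (v := v)) => n.
have c0 := indC_ge0 (v - n%:R).
apply: le_trans (fmul_le2l c0 (uz _ (ex_intro2 _ _ n I erefl))).
by rewrite [X in _ <= X]mulrC rmeet_mul // ![_ * (1 - _)]mulrC rmeet_ge lexx indC_sub_le.
Qed.

(** ** Square roots *)

(** The root is the supremum [v] of all [w >= 0] with [w * w <= u]. Here
    [v * v <= u] because [w * w' <= (w * w + w' * w') / 2 <= u]. If [d = u - v * v]
    were nonzero, a small multiple of [rmeet d 1], taken where [2 v + 1] is bounded,
    could be added to [v]. *)
Lemma sqrt_exists u : 0 <= u -> exists2 v : U, 0 <= v & v * v = u.
Proof.
move=> u0; pose V : set U := [set w : U | 0 <= w /\ w * w <= u].
have V0 : V 0 by split=> //; rewrite mulr0.
have [||v Vv] := dc (A := V); first by exists 0.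
  exists (u + 1) => w [w0 wu]; apply: (le_trans (y := w + w)).
    by rewrite -{1}[w]addr0 rleD2l.
  apply: (le_trans (y := w * w + 1 : U)); last by rewrite rleD2r.
  rewrite -rsub_ge0.
  suff -> : w * w + 1 - (w + w) = (w - 1) * (w - 1) by exact: fsqr_ge0.
  by ring.
have v0 : 0 <= v by apply: Vv.1.
have V2 w w' : V w -> V w' -> w * w' <= u.
  move=> [w0 wu] [w0' wu']; rewrite -(rscale_leP _ _ (ltr0n R 2)) !scaler_nat !mulr2n.
  apply: le_trans (rleD wu wu').
  rewrite -rsub_ge0.
  suff -> : w * w + w' * w' - (w * w' + w * w') = (w - w') * (w - w') by exact: fsqr_ge0.
  by ring.
have vvu : v * v <= u.
  apply: (sup_mul v0 Vv).2 => _ [w Vw <-]; rewrite mulrC.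
  apply: (sup_mul Vw.1 Vv).2 => _ [w' Vw' <-]; exact: V2.
exists v => //; apply/eqP; rewrite eq_sym -subr_eq0; apply/eqP.
set d : U := u - v * v; have d0 : 0 <= d by rewrite rsub_ge0.
have d1 : 0 <= rmeet d 1 by rewrite rmeet_ge0 ?fone_ge0.
suff e : rmeet d 1 = 0 by rewrite -[d]mulr1; apply: disj_mul0; rewrite ?fone_ge0.
apply: (exhaust_le (v := v + v + 1)) => // n; set c := 1 - ind _.
have c0 : 0 <= c := indC_ge0 _.
pose z : U := (n.+1%:R : R)^-1 *: (c * rmeet d 1).
have ni : 0 < (n.+1%:R : R)^-1 by rewrite invr_gt0 ltr0n.
have z0 : 0 <= z by rewrite riesz_scale_ge0 ?fmul_ge0 ?(ltW ni).
have c1 : c <= 1 by rewrite rle_subl -{1}[1]addr0 rleD2l ind_ge0.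
have cd1 : c * rmeet d 1 <= 1.
  by rewrite -[X in _ <= X]mul1r fmul_le ?rmeet_ler.
have z1 : z <= 1.
  apply: le_trans cd1; rewrite -[X in _ <= X]scale1r rscale_le2 ?fmul_ge0 //.
  by rewrite invf_le1 ?ltr0n // ler1n.
have zd : z * (v + v + z) <= d.
  apply: (le_trans (y := z * (v + v + 1))); first by rewrite fmul_le2l // rleD2l.
  rewrite -fscaleAl -(rscale_leP _ _ (ltr0n R n.+1)) scalerA divff ?pnatr_eq0 // scale1r.
  have -> : c * rmeet d 1 * (v + v + 1) = rmeet d 1 * (c * (v + v + 1)) by ring.
  apply: le_trans (fmul_le2l d1 (indC_nat_le _ _)) _.
  by rewrite scaler_nat mulr_natr rmuln_le ?rmeet_lel.
have /Vv.1 : V (v + z).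
  split; first by rewrite raddr_ge0.
  have -> : (v + z) * (v + z) = v * v + z * (v + v + z) by ring.
  by rewrite addrC -rle_subr.
rewrite -{2}[v]addr0 rleD2l => zle0.
have /eqP : z = 0 by apply/le_anti; rewrite zle0.
by rewrite scaler_eq0 invr_eq0 pnatr_eq0 /= => /eqP.
Qed.

Lemma sqrt_uniq (v w : U) : 0 <= v -> 0 <= w -> v * v = w * w -> v = w.
Proof. by move=> v0 w0 vw; apply/le_anti/andP; split; apply: le_sqr; rewrite ?vw. Qed.

End FAlgebra.

(** * Conditional expectations on an ideal *)

Definition updirected {R : realType} {E : rieszSpaceType R} (D : set E) :=
  D !=set0 /\ forall x y, D x -> D y -> exists2 z, D z & x <= z /\ y <= z.

Lemma updirected_image {R : realType} {E F : rieszSpaceType R} (h : E -> F) (D : set E) :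
  (forall x y, D x -> D y -> x <= y -> h x <= h y) ->
  updirected D -> updirected (h @` D).
Proof.
move=> hm [[x Dx] Dd]; split; first by exists (h x), x.
move=> _ _ [y Dy <-] [z Dz <-]; have [t Dt [yt zt]] := Dd _ _ Dy Dz.
by exists (h t); [exists t | rewrite !hm].
Qed.

Section Ideal.
Context {R : realType} {A : rieszSpaceType R} {mul : A -> A -> A} {one : A}.
Variable H : f_algebra mul one.
Notation U := (falg H).
Hypothesis dc : dedekind_complete U.
Implicit Types (x y z p q u v w c d g : U) (D : set U).

(** The original Riesz space, seen inside its universal completion: being
    Dedekind complete and order dense, it is an ideal containing the unit. *)
Record unital_ideal (I : set U) : Prop := {
  ideal_linear : linear_subspace I ;
  ideal_solid : solid I ;
  ideal_one : I 1
}.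

Variable I : set U.
Hypothesis idI : unital_ideal I.

Lemma ideal0 : I 0. Proof. by have [] := ideal_linear idI. Qed.

Lemma idealP (a : R) x y : I x -> I y -> I (a *: x + y).
Proof. by have [_] := ideal_linear idI; apply. Qed.

Lemma idealD x y : I x -> I y -> I (x + y).
Proof. by move=> Ix Iy; rewrite -[x]scale1r; apply: idealP. Qed.

Lemma idealZ (a : R) x : I x -> I (a *: x).
Proof. by move=> Ix; rewrite -[_ *: _]addr0; apply: idealP => //; exact: ideal0. Qed.

Lemma idealN x : I x -> I (- x).
Proof. by rewrite -scaleN1r; exact: idealZ. Qed.

Lemma idealB x y : I x -> I y -> I (x - y).
Proof. by move=> Ix Iy; apply/idealD/idealN. Qed.

Lemma ideal_le y x : I y -> 0 <= x -> x <= y -> I x.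
Proof.
move=> Iy x0 xy; apply: (ideal_solid idI) Iy _.
by rewrite rabs_id // (le_trans xy) // rabs_ge.
Qed.

Lemma ideal_pos x : I x -> I (rpos x).
Proof.
move=> Ix; apply: (ideal_solid idI) Ix _; rewrite (rabs_id (rpos_ge0 _)).
by rewrite rpos_le ?rabs_ge0 ?rabs_ge.
Qed.

Lemma ideal_neg x : I x -> I (rneg x).
Proof. by move=> Ix; rewrite rneg_def; apply/ideal_pos/idealN. Qed.

Lemma ideal_bounded (K : R) x : rabs x <= K *: (1 : U) -> I x.
Proof.
move=> xK; apply: (ideal_solid idI) (idealZ K (ideal_one idI)) _.
by rewrite (le_trans xK) // rabs_ge.
Qed.

Lemma ideal_mul (K : R) y g : 0 <= y -> y <= K *: (1 : U) -> I g -> I (y * g).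
Proof.
move=> y0 yK Ig; rewrite -[g]rposE mulrBr.
have h z : I z -> 0 <= z -> I (y * z).
  move=> Iz z0; apply: (ideal_le (idealZ K Iz)); first exact: fmul_ge0.
  by rewrite (fscaleE K z) fmul_le2r.
by apply: idealB; apply: h; rewrite ?rpos_ge0 ?rneg_ge0 //; [exact: ideal_pos | exact: ideal_neg].
Qed.

Lemma idem_le1Z p : p * p = p -> p <= (1 : R) *: (1 : U).
Proof. by move=> pp; rewrite scale1r idem_le1. Qed.

Lemma ideal_idem p : p * p = p -> I p.
Proof.
by move=> pp; apply: ideal_le (ideal_one idI) _ _; [exact: idem_ge0 | exact: idem_le1].
Qed.

Definition lower v : set U := [set g | [/\ I g, 0 <= g & g <= v]].

Lemma lower0 v : 0 <= v -> lower v 0.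
Proof. by split=> //; exact: ideal0. Qed.

Lemma lower_directed v : 0 <= v -> updirected (lower v).
Proof.
move=> v0; split=> [|x y [Ix x0 xv] [Iy y0 yv]]; first by exists 0; exact: lower0.
exists (rjoin x y); last by rewrite rjoin_lel rjoin_ler.
split; last by rewrite rjoin_le xv.
  apply: ideal_le (idealD Ix Iy) _ _; first by rewrite (le_trans x0) // rjoin_lel.
  by rewrite rjoin_le -{1}[x]addr0 -{2}[y]add0r rleD2r rleD2l x0 y0.
by rewrite (le_trans x0) // rjoin_lel.
Qed.

Lemma lower_meet v n : 0 <= v -> lower v (rmeet v n%:R).
Proof.
move=> v0; split; rewrite ?rmeet_lel ?rmeet_ge0 ?fnat_ge0 //.
apply: (ideal_bounded (K := n%:R)).
by rewrite rabs_id ?rmeet_ge0 ?fnat_ge0 // scaler_nat rmeet_ler.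
Qed.

Lemma lower_sup v : 0 <= v -> supremums (lower v) v.
Proof.
move=> v0; split=> [g [] //|z uz]; apply: (sup_truncation dc v0).2 => _ [n _ <-].
by apply: uz; exact: lower_meet.
Qed.

Record ideal_ce (S : U -> U) : Prop := {
  ice_mem : forall x, I x -> I (S x) ;
  ice_lin : forall (a : R) x y, I x -> I y -> S (a *: x + y) = a *: S x + S y ;
  ice_ge0 : forall x, I x -> 0 <= x -> 0 <= S x ;
  ice_eq0 : forall x, I x -> 0 <= x -> S x = 0 -> x = 0 ;
  ice_sup : forall D s, D `<=` I -> updirected D -> I s -> supremums D s ->
    supremums (S @` D) (S s) ;
  ice_proj : forall x, I x -> S (S x) = S x ;
  ice_join : forall x y, I x -> I y -> S x = x -> S y = y ->
    S (rjoin x y) = rjoin x y ;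
  ice_one : S 1 = 1
}.

Section CondExp.
Variable S : U -> U.
Hypothesis ceS : ideal_ce S.

Lemma ice0 : S 0 = 0.
Proof.
have := ice_lin ceS (-1) ideal0 ideal0; rewrite !scaleN1r oppr0 addr0 => ->.
by rewrite addNr.
Qed.

Lemma iceD x y : I x -> I y -> S (x + y) = S x + S y.
Proof. by move=> Ix Iy; have := ice_lin ceS 1 Ix Iy; rewrite !scale1r. Qed.

Lemma iceZ (a : R) x : I x -> S (a *: x) = a *: S x.
Proof. by move=> Ix; have := ice_lin ceS a Ix ideal0; rewrite ice0 !addr0. Qed.

Lemma iceN x : I x -> S (- x) = - S x.
Proof. by rewrite -!scaleN1r; exact: iceZ. Qed.

Lemma iceB x y : I x -> I y -> S (x - y) = S x - S y.
Proof. by move=> Ix Iy; rewrite iceD ?iceN //; exact: idealN. Qed.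

Lemma ice_le x y : I x -> I y -> x <= y -> S x <= S y.
Proof.
move=> Ix Iy xy; rewrite -rsub_ge0 -iceB //; apply: (ice_ge0 ceS); first exact: idealB.
by rewrite rsub_ge0.
Qed.

(** The extension of [S] to nonnegative elements of the algebra is only partial,
    hence a relation. *)
Definition is_ce v w := supremums (S @` lower v) w.

Lemma is_ce_ge v w g : is_ce v w -> lower v g -> S g <= w.
Proof. by move=> [u _] lg; apply: u; exists g. Qed.

Lemma is_ce_le v w z : is_ce v w -> (forall g, lower v g -> S g <= z) -> w <= z.
Proof. by move=> [_ l] h; apply: l => _ [g lg <-]; exact: h. Qed.

Lemma is_ce_ge0 v w : 0 <= v -> is_ce v w -> 0 <= w.
Proof. by move=> v0 /is_ce_ge/(_ (lower0 v0)); rewrite ice0. Qed.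

Lemma lower_le v v' g : v <= v' -> lower v g -> lower v' g.
Proof. by move=> vv' [Ig g0 gv]; split=> //; exact: le_trans vv'. Qed.

Lemma is_ce_mono v v' w w' : v <= v' -> is_ce v w -> is_ce v' w' -> w <= w'.
Proof.
by move=> vv' vw vw'; apply: is_ce_le vw _ => g /(lower_le vv') /(is_ce_ge vw').
Qed.

Lemma is_ce_dom v v' w' : 0 <= v -> v <= v' -> is_ce v' w' -> exists w, is_ce v w.
Proof.
move=> v0 vv' vw'; apply: dc; first by exists (S 0), 0 => //; exact: lower0.
by exists w' => _ [g /(lower_le vv') lg <-]; exact: is_ce_ge lg.
Qed.

Lemma is_ce_self g : I g -> 0 <= g -> is_ce g (S g).
Proof.
move=> Ig g0; split=> [_ [h [Ih h0 hg] <-]|z uz]; first exact: ice_le.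
by apply: uz; exists g.
Qed.

Lemma is_ceD v v' w w' : 0 <= v -> 0 <= v' -> is_ce v w -> is_ce v' w' ->
  is_ce (v + v') (w + w').
Proof.
move=> v0 v0' vw vw'; split=> [_ [g [Ig g0 gv] <-]|z uz].
  have m0 : 0 <= rmeet g v by rewrite rmeet_ge0.
  have Im : I (rmeet g v) by apply: ideal_le Ig m0 (rmeet_lel _ _).
  rewrite -[g](subrK (rmeet g v)) [X in S X]addrC iceD //; last exact: idealB.
  apply: rleD; first by apply: (is_ce_ge vw); split=> //; exact: rmeet_ler.
  apply: (is_ce_ge vw'); split; rewrite ?rsub_ge0 ?rmeet_lel //; first exact: idealB.
  rewrite rmeetE opprB addrC subrK rpos_le // rle_subl addrC //.
rewrite -rle_subr; apply: is_ce_le vw _ => g [Ig g0 gv].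
rewrite rle_subr addrC -rle_subr; apply: is_ce_le vw' _ => g' [Ig' g0' gv'].
rewrite rle_subr -iceD //; apply: uz; exists (g' + g) => //.
by split; [exact: idealD | exact: raddr_ge0 | rewrite addrC rleD].
Qed.

Lemma lowerZ (a : R) v g : 0 < a -> lower v g -> lower (a *: v) (a *: g).
Proof.
move=> a0 [Ig g0 gv]; split; first exact: idealZ.
- by apply: riesz_scale_ge0 => //; exact: ltW.
- by rewrite rscale_leP.
Qed.

Lemma is_ceZ (a : R) v w : 0 < a -> is_ce v w -> is_ce (a *: v) (a *: w).
Proof.
move=> a0 vw; have ai : 0 < a^-1 by rewrite invr_gt0.
split=> [_ [g lg <-]|z uz].
  have := lowerZ ai lg; rewrite scalerA mulVf ?gt_eqF // scale1r => /(is_ce_ge vw).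
  have [Ig _ _] := lg; rewrite iceZ // -(rscale_leP _ _ a0) scalerA divff ?gt_eqF //.
  by rewrite scale1r.
rewrite -(rscale_leP _ _ ai) scalerA mulVf ?gt_eqF // scale1r.
apply: is_ce_le vw _ => g lg; rewrite -(rscale_leP _ _ a0) scalerA divff ?gt_eqF //.
rewrite scale1r -iceZ; last by have [] := lg.
by apply: uz; exists (a *: g) => //; exact: lowerZ.
Qed.

(** Monotone convergence: a bound for [S] below the members of an upward
    directed family is a bound for [S] below its supremum. *)
Lemma is_ce_directed D v z : updirected D -> (forall d, D d -> 0 <= d) ->
  supremums D v -> (forall d g, D d -> lower d g -> S g <= z) ->
  forall g, lower v g -> S g <= z.
Proof.
move=> Dd D0 Dv Dz g [Ig g0 gv].
have gs := sup_meet g Dv; rewrite (rmeet_l gv) in gs.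
have I' : [set rmeet g d | d in D] `<=` I.
  by move=> _ [d Dd' <-]; apply: ideal_le Ig _ _; rewrite ?rmeet_lel ?rmeet_ge0 // D0.
have D' : updirected [set rmeet g d | d in D].
  by apply: updirected_image Dd => x y _ _ xy; rewrite rmeet_le.
apply: (ice_sup ceS I' D' Ig gs).2 => _ [_ [d Dd' <-] <-].
apply: (Dz _ _ Dd'); split; rewrite ?rmeet_ler ?rmeet_ge0 // ?D0 //.
by apply: I'; exists d.
Qed.

(** ** The averaging property *)

(** Idempotents play the role of events; the fixed ones are the events of the
    sub-sigma-algebra described by [S]. *)
Definition fixed_idem p := p * p = p /\ S p = p.

Lemma fixed_idem1 : fixed_idem 1.
Proof. by split; [rewrite mulr1 | exact: ice_one]. Qed.

Lemma fixed_idemC p : fixed_idem p -> fixed_idem (1 - p).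
Proof.
move=> [pp Sp]; split; first exact: idemC.
by rewrite iceB ?Sp ?(ice_one ceS) //; [exact: ideal_one | exact: ideal_idem].
Qed.

Lemma ice_supE D s : D `<=` I -> updirected D -> I s -> supremums D s ->
  (forall d, D d -> S d = d) -> S s = s.
Proof.
move=> DI Dd Is Ds SD; apply: sup_uniq (ice_sup ceS DI Dd Is Ds) _.
suff -> : S @` D = D by [].
by apply/seteqP; split=> [_ [d Dd' <-]|d Dd']; [rewrite SD | exists d => //; exact: SD].
Qed.

Lemma fix_pos x : I x -> S x = x -> S (rpos x) = rpos x.
Proof. by move=> Ix Sx; apply: (ice_join ceS) => //; [exact: ideal0 | exact: ice0]. Qed.

Lemma ideal_muln x n : I x -> I (x *+ n).
Proof. by move=> Ix; rewrite -scaler_nat; exact: idealZ. Qed.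

Lemma iceMn x n : I x -> S (x *+ n) = S x *+ n.
Proof. by move=> Ix; rewrite -!scaler_nat iceZ. Qed.

Lemma fix_meet x y : I x -> I y -> S x = x -> S y = y -> S (rmeet x y) = rmeet x y.
Proof.
move=> Ix Iy Sx Sy; rewrite rmeetE iceB //; last exact/ideal_pos/idealB.
by rewrite fix_pos ?Sx //; [exact: idealB | rewrite iceB ?Sx ?Sy].
Qed.

Lemma ind_fixed x : I x -> S x = x -> fixed_idem (ind x).
Proof.
move=> Ix Sx; split; first exact: ind_idem.
have In n : I (rpos x *+ n) by apply/ideal_muln/ideal_pos.
have I1 := ideal_one idI.
apply: (ice_supE _ _ _ (ind_sup dc x)).
- move=> _ [n _ <-]; apply: ideal_le I1 _ _; last exact: rmeet_ler.
  by rewrite rmeet_ge0 ?rmuln_ge0 ?rpos_ge0 ?fone_ge0.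
- split; first by exists (rmeet (rpos x *+ 0) 1), 0%N.
  move=> _ _ [m _ <-] [n _ <-]; exists (rmeet (rpos x *+ (m + n)) 1); first by exists (m + n)%N.
  by split; rewrite rmeet_le ?rmuln_le2 ?rpos_ge0 ?leq_addr ?leq_addl.
- exact/ideal_idem/ind_idem.
- move=> _ [n _ <-]; apply: fix_meet => //; last exact: ice_one.
  by rewrite iceMn ?fix_pos //; exact: ideal_pos.
Qed.

Lemma ice_split (P : U -> Prop) : (forall x y, I x -> I y -> P x -> P y -> P (x - y)) ->
  (forall x, I x -> 0 <= x -> P x) -> forall x, I x -> P x.
Proof.
move=> PB P0 x Ix; rewrite -[x]rposE.
have Ip := ideal_pos Ix; have In := ideal_neg Ix.
by apply: PB => //; apply: P0; rewrite ?rpos_ge0 ?rneg_ge0.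
Qed.

(** For [g <= n], positivity gives [S (p * g) <= n S p = n p], which [1 - p] kills;
    truncation reaches unbounded [g]. *)
Lemma fixed_idem_carried p g : fixed_idem p -> I g -> 0 <= g -> (1 - p) * S (p * g) = 0.
Proof.
move=> [pp Sp] Ig g0; have p0 := idem_ge0 pp; have q0 := idem_ge0 (idemC pp).
have Ip z : I z -> I (p * z) by apply: ideal_mul => //; exact: idem_le1Z.
apply/le_anti/andP; split; last first.
  by rewrite fmul_ge0 // (ice_ge0 ceS) ?fmul_ge0 //; exact: Ip.
have pgs := sup_mul dc p0 (sup_truncation dc g0).
set D := [set p * d | d in _] in pgs.
have DI : D `<=` I.
  by move=> _ [_ [n _ <-] <-]; apply: Ip; have [] := lower_meet n g0.
have Dd : updirected D.
  apply: updirected_image => [x y _ _ xy|]; first by rewrite fmul_le2l.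
  split; first by exists (rmeet g (0%:R : U)), 0%N.
  move=> _ _ [m _ <-] [n _ <-]; exists (rmeet g ((m + n)%:R : U)); first by exists (m + n)%N.
  by split; rewrite rmeet_le ?rmuln_le2 ?fone_ge0 ?leq_addr ?leq_addl.
apply: (sup_mul dc q0 (ice_sup ceS DI Dd (Ip _ Ig) pgs)).2.
move=> _ [_ [_ [_ [n _ <-] <-] <-] <-].
have -> : 0 = (1 - p) * (p *+ n) :> U by rewrite mulrnAr mulrBl mul1r pp subrr mul0rn.
have In : I (p *+ n) := ideal_muln n (ideal_idem pp).
rewrite fmul_le2l // -[X in _ <= X *+ n]Sp -iceMn; last exact: ideal_idem.
apply: ice_le => //; first by apply: Ip; have [] := lower_meet n g0.
by rewrite -[X in _ <= X]mulr_natr fmul_le2l ?rmeet_ler.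
Qed.

Lemma averaging_idem p g : fixed_idem p -> I g -> S (p * g) = p * S g.
Proof.
move=> Fp; have [pp _] := Fp; have p0 := idem_ge0 pp; have Fq := fixed_idemC Fp.
have Ip z : I z -> I (p * z) by apply: ideal_mul => //; exact: idem_le1Z.
move: g; apply: ice_split => [x y Ix Iy ex ey|g Ig g0].
  by rewrite mulrBr !iceB ?ex ?ey ?mulrBr //; exact: Ip.
have := fixed_idem_carried Fp Ig g0; rewrite mulrBl mul1r => /eqP.
rewrite subr_eq0 => /eqP ->.
have := fixed_idem_carried Fq Ig g0; rewrite opprB addrC subrK mulrBl mul1r.
by rewrite iceB ?mulrBr; [move=> /eqP; rewrite subr_eq0 => /eqP -> | | exact: Ip].
Qed.

Definition fixed_bounded y := S y = y /\ exists2 K : R, 0 < K & rabs y <= K *: (1 : U).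

Lemma fixed_bounded_ideal y : fixed_bounded y -> I y.
Proof. by move=> [_ [K _]]; exact: ideal_bounded. Qed.

Lemma rabs_sub_le x y z : 0 <= x -> 0 <= y -> x <= z -> y <= z -> rabs (x - y) <= z.
Proof.
move=> x0 y0 xz yz; rewrite rabs_le opprB !rle_subl; apply/andP.
by split; [rewrite -[x]addr0 rleD | rewrite -[y]addr0 rleD].
Qed.

(** Dyadic approximation: subtracting [(K/2) ind (y - K/2)] from [y] halves the
    bound [K] and keeps [y] in the range of [S]. *)
Lemma averaging_dyadic n (K : R) y g : 0 < K -> 0 <= y -> y <= K *: (1 : U) -> S y = y ->
  I g -> 0 <= g -> rabs (S (y * g) - y * S g) <= (K / 2 ^+ n) *: S g.
Proof.
move=> K0 y0 yK Sy Ig g0; elim: n K y K0 y0 yK Sy => [|n IH] K y K0 y0 yK Sy.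
  have Iyg := ideal_mul y0 yK Ig; have Sg0 := ice_ge0 ceS Ig g0.
  rewrite expr0 divr1 rabs_sub_le ?fmul_ge0 ?(ice_ge0 ceS) ?fmul_ge0 //.
    rewrite -iceZ //; apply: ice_le => //; first exact: idealZ.
    by rewrite (fscaleE K g) fmul_le2r.
  by rewrite (fscaleE K (S g)) fmul_le2r.
pose k : U := (K / 2) *: (1 : U); pose p := ind (y - k).
have K2 : 0 < K / 2 by rewrite divr_gt0 ?ltr0n.
have Iy : I y by apply: ideal_bounded (K) _ _; rewrite rabs_id.
have Ik : I k by exact: (idealZ _ (ideal_one idI)).
have Sk : S k = k by rewrite iceZ ?(ice_one ceS) //; exact: ideal_one.
have Fp : fixed_idem p.
  by apply: ind_fixed; [exact: idealB | rewrite iceB ?Sy ?Sk].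
have [pp Sp] := Fp; have p0 := idem_ge0 pp.
have Ip := ideal_idem pp.
have pk : p * k = (K / 2) *: p by rewrite [RHS]fscaleE mulrC.
have k2 : K *: (1 : U) = k + k by rewrite -scalerDl -splitr.
have py := ind_sub_ge dc y k; have qy := indC_sub_le dc y k; rewrite -/p in py qy.
pose y' : U := y - p * k.
have y0' : 0 <= y'.
  rewrite rsub_ge0 (le_trans py) // -[X in _ <= X]mul1r fmul_le2r //.
  exact: idem_le1.
have yk' : y' <= k.
  have -> : y' = (1 - p) * y + p * (y - k) by rewrite /y'; ring.
  apply: (le_trans (y := (1 - p) * k + p * k)); last by rewrite -mulrDl subrK mul1r.
  by rewrite rleD // fmul_le2l // rle_subl -k2.
have Ipk : I (p * k) by rewrite pk; exact: idealZ.
have Sy' : S y' = y' by rewrite /y' iceB // Sy pk iceZ // Sp.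
have Iyg z : 0 <= z -> z <= K *: (1 : U) -> I (z * g) by move=> z0 zK; exact: ideal_mul z0 zK Ig.
have := IH _ _ K2 y0' yk' Sy'; rewrite -mulrA -invfM -exprS => /(le_trans _); apply.
suff -> : S (y * g) - y * S g = S (y' * g) - y' * S g by [].
have -> : y * g = (K / 2) *: (p * g) + y' * g.
  by rewrite /y' pk mulrBl -fscaleAl addrC subrK.
have -> : y * S g = (K / 2) *: (p * S g) + y' * S g.
  by rewrite /y' pk mulrBl -fscaleAl addrC subrK.
rewrite (ice_lin ceS) ?(averaging_idem Fp Ig) //; last 2 first.
- by apply: ideal_mul Ig => //; exact: idem_le1Z.
- apply: Iyg => //; apply: le_trans yk' _; rewrite k2 -{1}[k]addr0 rleD2l.
  by rewrite riesz_scale_ge0 ?fone_ge0 ?ltW.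
by rewrite opprD addrACA subrr add0r.
Qed.

Lemma averaging_ge0 (K : R) y g : 0 < K -> 0 <= y -> y <= K *: (1 : U) -> S y = y ->
  I g -> 0 <= g -> S (y * g) = y * S g.
Proof.
move=> K0 y0 yK Sy Ig g0; apply/eqP; rewrite -subr_eq0; apply/eqP/rabs0_eq.
apply: (archimedean (y := K *: S g)) => // n.
have := averaging_dyadic n K0 y0 yK Sy Ig g0.
move=> /(rmuln_le n)/le_trans; apply; rewrite -scaler_nat scalerA.
apply: rscale_le2; last exact: (ice_ge0 ceS).
rewrite mulrA ler_pdivrMr ?exprn_gt0 ?ltr0n // mulrC ler_pM2l //.
by rewrite -natrX ler_nat ltnW // ltn_expl.
Qed.

Lemma averaging y g : fixed_bounded y -> I g -> S (y * g) = y * S g.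
Proof.
move=> Hy Ig; have Iy := fixed_bounded_ideal Hy; have [Sy [K K0 yK]] := Hy.
have yp : rpos y <= K *: (1 : U).
  by rewrite (le_trans _ yK) // rpos_le ?rabs_ge0 ?rabs_ge.
have yn : rneg y <= K *: (1 : U).
  by rewrite (le_trans _ yK) // rneg_def rpos_le ?rabs_ge0 ?rabs_geN.
have Sp : S (rpos y) = rpos y by exact: fix_pos.
have Sn : S (rneg y) = rneg y.
  by rewrite rneg_def fix_pos ?iceN ?Sy //; exact: idealN.
have Ipg z : I z -> I (rpos y * z) by move=> Iz; exact: ideal_mul (rpos_ge0 _) yp Iz.
have Ing z : I z -> I (rneg y * z) by move=> Iz; exact: ideal_mul (rneg_ge0 _) yn Iz.
move: g Ig; apply: ice_split => [x z Ix Iz ex ez|g Ig g0].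
  have Iyz u : I u -> I (y * u).
    by move=> Iu; rewrite -[y]rposE mulrBl; apply: idealB; [exact: Ipg | exact: Ing].
  by rewrite mulrBr !iceB ?ex ?ez ?mulrBr //; exact: Iyz.
rewrite -{1 2}[y]rposE !mulrBl iceB; [|exact: Ipg|exact: Ing].
by rewrite (averaging_ge0 K0 _ yp) ?(averaging_ge0 K0 _ yn) ?rpos_ge0 ?rneg_ge0.
Qed.

(** ** Measurable elements *)

Lemma fixed_bounded_intro (K : R) y : 0 <= K -> S y = y -> rabs y <= K *: (1 : U) ->
  fixed_bounded y.
Proof.
move=> K0 Sy yK; split=> //; exists (K + 1); first by rewrite ltr_wpDl ?ltr01.
by rewrite (le_trans yK) // rscale_le2 ?fone_ge0 // lerDl.
Qed.

Lemma fixed_bounded_idem p : fixed_idem p -> fixed_bounded p.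
Proof.
move=> [pp Sp]; apply: (fixed_bounded_intro (K := 1)) => //.
by rewrite scale1r rabs_id ?idem_ge0 ?idem_le1.
Qed.

Lemma fixed_boundedD x y : fixed_bounded x -> fixed_bounded y -> fixed_bounded (x + y).
Proof.
move=> Hx Hy; have Ix := fixed_bounded_ideal Hx; have Iy := fixed_bounded_ideal Hy.
move: Hx Hy => [Sx [K K0 xK]] [Sy [L L0 yL]].
apply: (fixed_bounded_intro (K := K + L)); first by rewrite addr_ge0 ?ltW.
  by rewrite iceD // Sx Sy.
by rewrite scalerDl (le_trans (rabsD _ _)) // rleD.
Qed.

Lemma fixed_boundedN x : fixed_bounded x -> fixed_bounded (- x).
Proof.
move=> Hx; have Ix := fixed_bounded_ideal Hx; move: Hx => [Sx [K K0 xK]].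
by split; [rewrite iceN ?Sx | exists K; rewrite // rabsN].
Qed.

Lemma fixed_boundedM x y : fixed_bounded x -> fixed_bounded y -> fixed_bounded (x * y).
Proof.
move=> Hx Hy; have Iy := fixed_bounded_ideal Hy.
have Sxy : S (x * y) = x * y by rewrite averaging //; have [-> _] := Hy.
move: Hx Hy => [_ [K K0 xK]] [_ [L L0 yL]].
apply: (fixed_bounded_intro (K := K * L)) => //; first by rewrite mulr_ge0 ?ltW.
have KL : rabs x * rabs y <= (K * L) *: (1 : U).
  rewrite -scalerA fscaleE fmul_le ?rabs_ge0 //.
exact: le_trans (rabs_mul_le _ _) KL.
Qed.

Lemma fixed_bounded_pos x : fixed_bounded x -> fixed_bounded (rpos x).
Proof.
move=> Hx; have Ix := fixed_bounded_ideal Hx; move: Hx => [Sx [K K0 xK]].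
split; first exact: fix_pos.
exists K => //; rewrite (le_trans _ xK) // (rabs_id (rpos_ge0 _)).
by rewrite rpos_le ?rabs_ge0 ?rabs_ge.
Qed.

Lemma fixed_idemM p q : fixed_idem p -> fixed_idem q -> fixed_idem (p * q).
Proof.
move=> Fp Fq; split; first by have [? _] := Fp; have [? _] := Fq; exact: idemM.
by have [] := fixed_boundedM (fixed_bounded_idem Fp) (fixed_bounded_idem Fq).
Qed.

(** The elements measurable for the extension of [S] to the algebra, bounded or
    not: those which are bounded members of the range of [S] on fixed idempotents
    whose supremum is the unit. *)
Definition measurable u := forall x, 0 <= x ->
  (forall p, fixed_idem p -> fixed_bounded (p * u) -> p * x = 0) -> x = 0.

Lemma measurable_unary u w :
  (forall p, fixed_idem p -> fixed_bounded (p * u) -> fixed_bounded (p * w)) ->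
  measurable u -> measurable w.
Proof. by move=> uw mu x x0 wx; apply: mu => // p Fp /(uw p Fp); exact: wx. Qed.

Lemma measurable_binary u v w :
  (forall p q, fixed_idem p -> fixed_idem q -> fixed_bounded (p * u) ->
     fixed_bounded (q * v) -> fixed_bounded ((p * q) * w)) ->
  measurable u -> measurable v -> measurable w.
Proof.
move=> uvw mu mv x x0 wx; apply: mu => // p Fp pu; apply: mv.
  by rewrite fmul_ge0 //; have [/idem_ge0] := Fp.
move=> q Fq qv; rewrite mulrA [q * p]mulrC; apply: wx; first exact: fixed_idemM.
exact: uvw.
Qed.

Lemma measurable_fixed u : fixed_bounded u -> measurable u.
Proof.
by move=> Hu x x0 h; rewrite -[x]mul1r; apply: h; [exact: fixed_idem1 | rewrite mul1r].
Qed.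

Lemma measurable1 : measurable 1.
Proof. exact: (measurable_fixed (fixed_bounded_idem fixed_idem1)). Qed.

Lemma measurableD u v : measurable u -> measurable v -> measurable (u + v).
Proof.
apply: measurable_binary => p q /fixed_bounded_idem Hp /fixed_bounded_idem Hq pu qv.
have -> : (p * q) * (u + v) = q * (p * u) + p * (q * v) by ring.
by apply: fixed_boundedD; apply: fixed_boundedM.
Qed.

Lemma measurableM u v : measurable u -> measurable v -> measurable (u * v).
Proof.
apply: measurable_binary => p q _ _ pu qv; rewrite mulrACA; exact: fixed_boundedM.
Qed.

Lemma measurableN u : measurable u -> measurable (- u).
Proof. by apply: measurable_unary => p _; rewrite mulrN; exact: fixed_boundedN. Qed.

Lemma measurableB u v : measurable u -> measurable v -> measurable (u - v).
Proof. by move=> mu mv; apply/measurableD/measurableN. Qed.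

Lemma measurable_pos u : measurable u -> measurable (rpos u).
Proof.
apply: measurable_unary => p [/idem_ge0 p0 _] /fixed_bounded_pos.
by rewrite mulrC rpos_mul // mulrC.
Qed.

Lemma measurable_abs u : measurable u -> measurable (rabs u).
Proof.
move=> mu; rewrite rabsE rneg_def; apply: measurableD; apply: measurable_pos => //.
exact: measurableN.
Qed.

Lemma measurableZ1 (a : R) : measurable (a *: (1 : U)).
Proof.
apply: measurable_fixed; split; first by rewrite iceZ ?(ice_one ceS) //; exact: ideal_one.
exists (`|a| + 1); first by rewrite ltr_wpDl ?ltr01.
rewrite rabs_le -scaleNr !rscale_le2 ?fone_ge0 // ler_wpDr // ?ler_norm //.
by rewrite -normrN ler_norm.
Qed.

Lemma ind_idem_mul p u : p * p = p -> ind (p * u) = p * ind u.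
Proof.
move=> pp; have p0 := idem_ge0 pp; apply: ind_uniq => //.
- by rewrite idemM // ind_idem.
- rewrite [p * u]mulrC rpos_mul //.
  have -> : p * ind u * (rpos u * p) = (ind u * rpos u) * (p * p) by ring.
  by rewrite ind_rpos // pp.
- move=> z z0; rewrite [p * u]mulrC rpos_mul // => zu; rewrite mulrA.
  by apply: ind_disj => //; [rewrite fmul_ge0 | rewrite -mulrA [p * _]mulrC].
Qed.

Lemma measurable_ind u : measurable u -> measurable (ind u).
Proof.
apply: measurable_unary => p [pp _] pu; rewrite -ind_idem_mul //.
by apply/fixed_bounded_idem/ind_fixed; [exact: fixed_bounded_ideal | have [] := pu].
Qed.

(** On each fixed idempotent [p] for which [p * u] is in the range of [S],
    averaging gives [p * (S u - u) = S (p * u) - p * u = 0], and such [p] exhaust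
    the unit. *)
Lemma measurable_bounded (K : R) u : 0 <= K -> rabs u <= K *: (1 : U) -> measurable u ->
  fixed_bounded u.
Proof.
move=> K0 uK mu; apply: (fixed_bounded_intro K0) => //.
have Iu := ideal_bounded uK.
apply/eqP; rewrite -subr_eq0; apply/eqP/rabs0_eq.
suff -> : rabs (S u - u) = 0 by [].
apply: mu; first exact: rabs_ge0.
move=> p Fp [Spu _]; have [pp _] := Fp; have p0 := idem_ge0 pp.
apply: fsqr_eq0 => //; apply/le_anti; rewrite fsqr_ge0 andbT.
have e : p * (S u - u) = 0 by rewrite mulrBr -averaging_idem // Spu subrr.
have -> : p * rabs (S u - u) * (p * rabs (S u - u)) = p * (rabs (S u - u) * rabs (S u - u)) * p by ring.
by rewrite rabs_sqr mulrA e !mul0r.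
Qed.

(** Each truncation of [w] at a constant is a directed supremum of elements in
    the range of [S], hence lies in that range; the fixed idempotents are
    the sets where [w <= n], detected on the truncation at [n + 1]. *)
Lemma is_ce_measurable v w : 0 <= v -> is_ce v w -> measurable w.
Proof.
move=> v0 vw; have w0 := is_ce_ge0 v0 vw.
have fw n : fixed_bounded (rmeet w n%:R).
  have n0 := fnat_ge0 H n; have m0 : 0 <= rmeet w n%:R by rewrite rmeet_ge0.
  apply: (fixed_bounded_intro (K := n%:R)); first exact: ler0n; last first.
    by rewrite rabs_id // scaler_nat rmeet_ler.
  have In : I (n%:R : U) by apply: ideal_muln; exact: ideal_one.
  have Sn : S n%:R = n%:R by rewrite iceMn ?(ice_one ceS) //; exact: ideal_one.
  have ws := sup_meet (n%:R : U) vw; rewrite rmeetC; set D := [set _ | _ in _] in ws.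
  have Sg0 g : lower v g -> 0 <= S g by move=> [Ig g0 _]; exact: (ice_ge0 ceS).
  have DI : D `<=` I.
    by move=> _ [_ [g lg <-] <-]; apply: ideal_le In _ _; rewrite ?rmeet_lel // rmeet_ge0 // Sg0.
  apply: (ice_supE DI _ _ ws).
  - apply: updirected_image => [x y _ _ xy|]; first by rewrite rmeet_le.
    apply: updirected_image (lower_directed v0) => x y [Ix _ _] [Iy _ _].
    exact: ice_le.
  - by apply: ideal_le In _ _; rewrite ?rmeet_lel // rmeet_ge0.
  - move=> _ [_ [g [Ig _ _] <-] <-].
    by apply: fix_meet => //; [exact: (ice_mem ceS) | exact: (ice_proj ceS)].
move=> x x0 hx; pose y n : U := rmeet w n.+1%:R - n%:R.
have Fy n : fixed_idem (ind (y n)).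
  have Hn : fixed_bounded (n%:R : U).
    apply: (fixed_bounded_intro (K := n%:R)); first exact: ler0n.
      by rewrite iceMn ?(ice_one ceS) //; exact: ideal_one.
    by rewrite rabs_id ?fnat_ge0 // scaler_nat.
  have Hy : fixed_bounded (y n) by apply/fixed_boundedD/fixed_boundedN.
  by apply: ind_fixed; [exact: fixed_bounded_ideal | have [] := Hy].
apply/le_anti; rewrite x0 andbT; apply: (archimedean (y := x * w)) => // n.
set c := 1 - ind (y n); have Fc : fixed_idem c by exact: fixed_idemC.
have [cc _] := Fc; have c0 := idem_ge0 cc.
have cx : c * x = 0.
  apply: hx => //; suff -> : c * w = c * rmeet w n%:R.
    by apply: fixed_boundedM; [exact: fixed_bounded_idem | exact: fw].
  (* [c] kills [rmeet (rpos (w - n)) 1], hence is disjoint from [rpos (w - n)]. *)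
  have ct : c * rpos (w - n%:R) = 0.
    have t1 : rmeet (rpos (w - n%:R)) 1 = rpos (y n).
      rewrite rmeet_pos ?fone_ge0 // /y rmeetDr; congr (rpos (rmeet _ _)).
      by rewrite mulrSr addrC addKr.
    have : rmeet (c * rpos (w - n%:R)) c = 0.
      by rewrite -[X in rmeet _ X]mul1r mulrC -rmeet_mul // t1 mulrC indC_rpos.
    have ct0 : 0 <= c * rpos (w - n%:R) by rewrite fmul_ge0 ?rpos_ge0.
    by move/(disj_mul0 ct0 c0); rewrite mulrAC cc.
  by rewrite rmeetE mulrBr ct subr0.
have xn : ind (y n) * x = x.
  by have /eqP := cx; rewrite mulrBl mul1r subr_eq0 => /eqP.
have := fmul_le2r x0 (ind_sub_ge dc (rmeet w n.+1%:R) n%:R).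
rewrite -/(y n) mulrAC xn mulrAC xn mulr_natr => /le_trans; apply.
by rewrite fmul_le2l ?rmeet_lel.
Qed.

End CondExp.

(** ** Towers of conditional expectations *)

Section Tower.
Variables S S' : U -> U.
Hypotheses (ceS : ideal_ce S) (ceS' : ideal_ce S').
Hypothesis tower : forall x, I x -> S (S' x) = S x.

(** Pulling out [y] and the tower property in one step: for [g <= a],
    [S (y * S' g) = S (S' (y * g)) = S (y * g)], and [y * a] and [y * v] are the
    suprema of the directed families [y * g] and [y * S' g]. *)
Lemma is_ce_tower_mul y a v w : 0 <= y -> fixed_bounded S' y -> 0 <= a ->
  is_ce S' a v -> is_ce S (y * a) w -> is_ce S (y * v) w.
Proof.
move=> y0 Hy a0 av [uw lw]; have [Sy [K K0 yK]] := Hy.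
have y1 : y <= K *: (1 : U) by rewrite (le_trans (rabs_ge y)).
have Iy x : I x -> I (y * x) by exact: ideal_mul y0 y1.
have dir h : (forall x x', I x -> I x' -> x <= x' -> h x <= h x') ->
    updirected [set y * d | d in h @` lower a].
  move=> hm; apply: updirected_image => [x x' _ _ xx'|]; first by rewrite fmul_le2l.
  by apply: updirected_image (lower_directed a0) => x x' [Ix _ _] [Ix' _ _]; exact: hm.
have Sg0 g : lower a g -> 0 <= S' g by move=> [Ig g0 _]; exact: (ice_ge0 ceS').
have Syg g : lower a g -> S (y * S' g) = S (y * g).
  by move=> [Ig _ _]; rewrite -(averaging ceS' Hy Ig) tower //; exact: Iy.
split=> [_ [g lg <-]|z uz].
  have D1 := dir S' (ice_le ceS').
  apply: (is_ce_directed ceS D1 _ (sup_mul dc y0 av)) lg => [_ [_ [g' lg' <-] <-]|].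
    by rewrite fmul_ge0 // Sg0.
  move=> _ g' [_ [h lh <-] <-] [Ig' g0' g'y].
  have [Ih h0 ha] := lh.
  apply: (le_trans (y := S (y * S' h))).
    by apply: ice_le => //; apply/Iy/(ice_mem ceS').
  by rewrite Syg //; apply: uw; exists (y * h) => //; split; [exact: Iy | exact: fmul_ge0 | exact: fmul_le2l].
apply: lw => _ [g lg <-].
have D1 : updirected [set y * d | d in id @` lower a] by apply: dir.
rewrite image_id in D1.
apply: (is_ce_directed ceS D1 _ (sup_mul dc y0 (lower_sup a0))) lg => [_ [g' [_ g0 _] <-]|].
  exact: fmul_ge0.
move=> _ g' [h lh <-] [Ig' g0' g'y]; have [Ih h0 ha] := lh.
apply: (le_trans (y := S (y * h))); first by apply: ice_le => //; exact: Iy.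
rewrite -Syg //; apply: uz; exists (y * S' h) => //; split.
- exact/Iy/(ice_mem ceS').
- by rewrite fmul_ge0 // Sg0.
- by rewrite fmul_le2l //; exact: is_ce_ge lh.
Qed.

(** Where [c n] lives, [B] is bounded by [y n]. Making the [c n] disjoint as
    [d n = (1 - c 0) ... (1 - c (n-1)) c n], the disjoint elements [d n * y n] have a
    supremum, which bounds [B] on every [d n]. *)
Lemma lateral_bound (B : set U) (c y : nat -> U) : laterally_complete U ->
  (forall n, c n * c n = c n) ->
  (forall x, 0 <= x -> (forall n, c n * x = 0) -> x = 0) ->
  (forall n, 0 <= y n) ->
  (forall b n, B b -> c n * b <= c n * y n) -> exists u, ubound B u.
Proof.
move=> lat cc cx y0 By.
pose r := fix r n : U := if n is m.+1 then r m * (1 - c m) else 1.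
have rr n : r n * r n = r n.
  by elim: n => [|n IH] /=; [rewrite mulr1 | rewrite idemM // idemC].
have rc m n : (m < n)%N -> r n * c m = 0.
  elim: n => // n IH; rewrite ltnS leq_eqVlt => /orP[/eqP ->|/IH e] /=.
    by rewrite -mulrA mulrBl mul1r cc subrr mulr0.
  by rewrite mulrAC e mul0r.
pose d n := r n * c n.
have dd n : d n * d n = d n by exact: idemM.
have d0 n : 0 <= d n := idem_ge0 (dd n).
have dy0 n : 0 <= d n * y n by rewrite fmul_ge0.
have dmn m n : (m < n)%N -> (d m * y m) * (d n * y n) = 0.
  move=> mn; rewrite /d.
  have -> : r m * c m * y m * (r n * c n * y n) = (r n * c m) * (r m * y m * c n * y n) by ring.
  by rewrite rc // mul0r.
have [||_ _ [m _ <-] [n _ <-] mn|u uB] := lat (range (fun n => d n * y n)).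
- by exists (d 0%N * y 0%N), 0%N.
- by move=> _ [n _ <-].
- apply: mul0_disj => //; have [e|e|e] := ltngtP m n; first exact: dmn.
    by rewrite mulrC dmn.
  by rewrite e in mn.
exists u => b Bb; rewrite -[u]add0r -rle_subl.
apply: (exhaust_rpos d0) => [x x0 dx|n].
  have rx n : r n * x = x.
    elim: n => [|n IH] /=; first by rewrite mul1r.
    have -> : r n * (1 - c n) * x = r n * x - d n * x by rewrite /d; ring.
    by rewrite IH dx subr0.
  by apply: cx => // n; rewrite -(rx n) mulrA [c n * _]mulrC dx.
rewrite mulrBr rle_subl add0r; apply: (le_trans (y := d n * (d n * y n))).
  by rewrite mulrA dd /d -!mulrA fmul_le2l ?By //; exact: idem_ge0.
by rewrite fmul_le2l // uB.1 //; exists n.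
Qed.

(** On a nonzero component where [S' g], for [g <= v], is unbounded, [S (S' g) = S g]
    would exceed every bound, whereas it stays below the value of [S] at [v]. *)
Lemma is_ce_tower v w : laterally_complete U -> 0 <= v -> is_ce S v w ->
  exists w', is_ce S' v w'.
Proof.
move=> lat v0 vw; pose B := S' @` lower v.
have B0 b : B b -> 0 <= b by move=> [g [Ig g0 _] <-]; exact: (ice_ge0 ceS').
have Bd : updirected B.
  apply: updirected_image (lower_directed v0) => x x' [Ix _ _] [Ix' _ _].
  exact: ice_le.
have Bex : B !=set0 by have [] := Bd.
have yex n : exists y, supremums [set rmeet (n%:R : U) b | b in B] y.
  apply: dc; first by have [b Bb] := Bex; exists (rmeet (n%:R : U) b), b.
  by exists (n%:R : U) => _ [b _ <-]; exact: rmeet_lel.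
have [y yB] := choice yex.
have y0 n : 0 <= y n.
  have [b Bb] := Bex; apply: (le_trans (y := rmeet (n%:R : U) b)).
    by rewrite rmeet_ge0 ?fnat_ge0 ?B0.
  by apply: (yB n).1; exists b.
have yn n : y n <= (n%:R : U) by apply: (yB n).2 => _ [b _ <-]; exact: rmeet_lel.
have In n : I (n%:R : U) by apply: ideal_muln; exact: ideal_one.
have Iy n : I (y n) by exact: ideal_le (In n) (y0 n) (yn n).
suff [u uB] : exists u, ubound B u by apply: dc => //; exists u.
(* [y n] is the supremum of [B] cut at [n]; where it stays below [n], the cut is
   ineffective and [y n] bounds [B] itself. *)
apply: (@lateral_bound _ (fun n => ind ((n%:R : U) - y n)) y) => // [n|x x0 cx|b n Bb].
- exact: ind_idem.
- have x1 : 0 <= rmeet x 1 by rewrite rmeet_ge0 ?fone_ge0.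
  suff e : rmeet x 1 = 0 by rewrite -[x]mulr1; apply: disj_mul0; rewrite ?fone_ge0.
  have I1 : I (rmeet x 1) by apply: ideal_le (ideal_one idI) x1 (rmeet_ler _ _).
  apply: (ice_eq0 ceS) => //; apply/le_anti; rewrite (ice_ge0 ceS) // andbT.
  apply: (archimedean (y := w)) => // n; rewrite -iceMn //.
  have ci : ind ((n%:R : U) - y n) * rmeet x 1 = 0.
    apply/le_anti; rewrite fmul_ge0 ?ind_ge0 // andbT -(cx n).
    by rewrite fmul_le2l ?rmeet_lel ?ind_ge0.
  have xny : rmeet x 1 *+ n <= y n.
    have := ind_mul dc ((n%:R : U) - y n); rewrite rpos_id ?rsub_ge0 // => e.
    have : rmeet x 1 * ((n%:R : U) - y n) = 0 by rewrite -e mulrA [_ * ind _]mulrC ci mul0r.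
    rewrite mulrBr => /eqP; rewrite subr_eq0 mulr_natr => /eqP ->.
    by rewrite -[X in _ <= X]mul1r fmul_le2r ?rmeet_ler.
  apply: (le_trans (y := S (y n))); first by apply: ice_le => //; exact: ideal_muln.
  have DI : [set rmeet (n%:R : U) b | b in B] `<=` I.
    by move=> _ [b Bb <-]; apply: ideal_le (In n) _ (rmeet_lel _ _); rewrite rmeet_ge0 ?fnat_ge0 ?B0.
  have Dd : updirected [set rmeet (n%:R : U) b | b in B].
    by apply: updirected_image Bd => b b' _ _ bb'; rewrite rmeet_le.
  apply: (ice_sup ceS DI Dd (Iy n) (yB n)).2 => _ [_ [b Bb <-] <-].
  have [g lg gb] := Bb; have [Ig _ _] := lg.
  have Ib : I b by rewrite -gb; exact: (ice_mem ceS').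
  apply: (le_trans (y := S b)); last by rewrite -gb tower //; exact: is_ce_ge lg.
  by apply: ice_le => //; [apply: DI; exists b | exact: rmeet_ler].
- rewrite -[X in _ <= X]add0r -rle_subl -mulrBr.
  have t0 : 0 <= (n%:R : U) - y n by rewrite rsub_ge0.
  apply: (le_trans (y := ind ((n%:R : U) - y n) * rpos (b - y n))).
    by rewrite fmul_le2l ?ind_ge0 ?rpos_ge.
  rewrite mulrC ind_disj ?rpos_ge0 // (rpos_id t0).
  apply: disj_mul0; rewrite ?rpos_ge0 // rmeet_pos // -rmeetDr; apply/rpos_eq0.
  by rewrite rle_subl add0r rmeetC; apply: (yB n).1; exists b.
Qed.

End Tower.

End Ideal.

(** * The weak type inequality in the algebra *)

Section Pathwise.
Context {R : realType} {A : rieszSpaceType R} {mul : A -> A -> A} {one : A}.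
Variable H : f_algebra mul one.
Notation U := (falg H).
Hypothesis dc : dedekind_complete U.
Implicit Types (x : U) (n : nat).

Variables (f s : nat -> U) (lambda : R).
Hypothesis s_ge0 : forall n, 0 <= s n.
Hypothesis s_0 : s 0%N * s 0%N = f 0%N * f 0%N.
Hypothesis s_S : forall n,
  s n.+1 * s n.+1 = s n * s n + (f n.+1 - f n) * (f n.+1 - f n).
Hypothesis lambda_gt0 : 0 < lambda.

Local Ltac nonneg := repeat first
  [ assumption | apply: fnat_ge0 | apply: fsqr_ge0 | apply: fmul_ge0 | apply: raddr_ge0 ].

Let l : U := lambda *: (1 : U).

(** The set where [|f n| <= l] and [s n <= l]; the second condition is stated with
    squares, so that its measurability does not involve square roots. *)
Definition alive n : U := (1 - ind (rabs (f n) - l)) * (1 - ind (s n * s n - l * l)).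

Fixpoint unstopped n : U :=
  if n is m.+1 then unstopped m * alive m.+1 else alive 0%N.

(** The martingale transform of [f] by [2 * 1_{n < tau} * f n], where [tau] is the
    first exit time from the sets [alive n]. *)
Fixpoint transform n : U :=
  if n is m.+1 then transform m + 2 * (unstopped m * f m) * (f m.+1 - f m) else 0.

Lemma level_ge0 : 0 <= l.
Proof. by rewrite riesz_scale_ge0 ?fone_ge0 ?ltW. Qed.

Lemma square_le n : s n <= s n.+1.
Proof. by apply: le_sqr => //; rewrite s_S -{1}[s n * s n]addr0 rleD2l fsqr_ge0. Qed.

Lemma diff_le_square n : rabs (f n.+1 - f n) <= s n.+1.
Proof.
apply: le_sqr => //; first exact: rabs_ge0.
by rewrite s_S rabs_sqr -{1}[X in X <= _]add0r rleD2r fsqr_ge0.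
Qed.

Lemma square_le_diff n : s n.+1 <= s n + rabs (f n.+1 - f n).
Proof.
have r0 := rabs_ge0 (f n.+1 - f n).
apply: le_sqr => //; first by rewrite raddr_ge0.
rewrite s_S -(rabs_sqr (f n.+1 - f n)) -rsub_ge0; set d := rabs _ in r0 *.
have -> : (s n + d) * (s n + d) - (s n * s n + d * d) = s n * d + s n * d by ring.
by rewrite raddr_ge0 ?fmul_ge0.
Qed.

Lemma square0 : s 0%N = rabs (f 0%N).
Proof. by apply: sqrt_uniq => //; [exact: rabs_ge0 | rewrite rabs_sqr]. Qed.

Lemma alive_idem n : alive n * alive n = alive n.
Proof. by apply: idemM; apply: indC_idem. Qed.

Lemma unstopped_idem n : unstopped n * unstopped n = unstopped n.
Proof. by elim: n => [|n IH] /=; [exact: alive_idem | exact: idemM IH (alive_idem _)]. Qed.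

Lemma alive_le n : alive n * rabs (f n) <= alive n * l /\ alive n * s n <= alive n * l.
Proof.
set a := 1 - ind (rabs (f n) - l); set b := 1 - ind (s n * s n - l * l).
have a0 : 0 <= a := indC_ge0 dc _; have b0 : 0 <= b := indC_ge0 dc _.
have E : alive n = a * b by []. have E' : alive n = b * a by rewrite E mulrC.
split; first by rewrite E' -!mulrA fmul_le2l //; exact: indC_sub_le.
have r0 : 0 <= alive n := idem_ge0 (alive_idem n).
apply: le_sqr; rewrite ?fmul_ge0 ?level_ge0 //.
rewrite [X in X <= _]mulrACA [X in _ <= X]mulrACA !alive_idem E -!mulrA fmul_le2l //.
exact: indC_sub_le.
Qed.

Lemma unstopped_factor n : exists2 c : U, 0 <= c & unstopped n = c * alive n.
Proof.
case: n => [|n]; first by exists 1; rewrite ?fone_ge0 ?mul1r.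
by exists (unstopped n) => //; exact/idem_ge0/unstopped_idem.
Qed.

Lemma unstopped_le n :
  unstopped n * rabs (f n) <= unstopped n * l /\ unstopped n * s n <= unstopped n * l.
Proof.
have [c c0 ->] := unstopped_factor n; have [h1 h2] := alive_le n.
by rewrite -!(mulrA c); split; apply: fmul_le2l.
Qed.

Lemma dead_ge n x : rabs (f n) <= x -> s n <= x -> (1 - alive n) * l <= (1 - alive n) * x.
Proof.
move=> fx sx; set a := 1 - ind (rabs (f n) - l); set b := 1 - ind (s n * s n - l * l).
have a0 : 0 <= a := indC_ge0 dc _.
have ai : 1 - a = ind (rabs (f n) - l) by rewrite /a; ring.
have bi : 1 - b = ind (s n * s n - l * l) by rewrite /b; ring.
have h1 : (1 - a) * l <= (1 - a) * x.
  rewrite ai (le_trans (ind_sub_ge dc _ _)) // fmul_le2l ?ind_ge0 //.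
have h2 : (1 - b) * l <= (1 - b) * x.
  rewrite bi; apply: (le_trans (y := ind (s n * s n - l * l) * s n)); last first.
    by rewrite fmul_le2l ?ind_ge0.
  apply: le_sqr; rewrite ?fmul_ge0 ?ind_ge0 ?level_ge0 //.
  by rewrite [X in X <= _]mulrACA [X in _ <= X]mulrACA !ind_idem //; exact: ind_sub_ge.
have -> : 1 - alive n = (1 - a) + a * (1 - b).
  by rewrite -[alive n]/(a * b); ring.
rewrite [X in X <= _]mulrDl [X in _ <= X]mulrDl; apply: rleD => //.
by rewrite -!(mulrA a); apply: fmul_le2l.
Qed.

(** As long as no exit has occurred, the transform telescopes, by
    [2 f (f' - f) = f'^2 - f^2 - (f' - f)^2]. *)
Lemma unstopped_transform n :
  unstopped n * transform n = unstopped n * (f n * f n - s n * s n).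
Proof.
elim: n => [|n IH] /=; first by rewrite s_0 subrr.
set r := unstopped n in IH *; set k := alive _; set W := transform n in IH *.
have rr : r * r = r := unstopped_idem n.
transitivity (k * (r * W) + 2 * k * (r * r) * f n * (f n.+1 - f n)); first by ring.
by rewrite IH rr s_S; ring.
Qed.

(** Write [r] for [unstopped n], [k] for [alive n.+1], [t'] for [s n.+1], and split
    the unit into [1 - r], [r * k], [r * (1 - k)]: paths stopped by time [n], not yet
    stopped at time [n.+1], and stopped exactly then. On the first part the
    transform is frozen and the square function only grows. On the second one the
    transform is [f^2 - t'^2 >= - l t']. On the third one, with [a = |f n|],
    the transform is at least [a^2 - 3 l t'] because [a], [s n] are at most [l] and
    [|f n.+1 - f n| <= t'], while [l <= a + t']; so that [4 (a^2 - 3 l t') + 14 l t' - l^2]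
    is at least [4 a^2 + 2 l (l - a) - l^2 = (a - l)^2 + 3 a^2]. *)
Lemma pathwise_bound n :
  l * l * (1 - unstopped n) <= 4 * transform n + 14 * (l * s n).
Proof.
have l0 := level_ge0.
elim: n => [|n IH] /=.
  rewrite mulr0 add0r; set k := alive 0%N.
  have kk : k * k = k := alive_idem 0.
  have h : (1 - k) * l <= (1 - k) * s 0%N by apply: dead_ge; rewrite ?square0.
  rewrite -rsub_ge0.
  have -> : 14 * (l * s 0%N) - l * l * (1 - k) = l * ((1 - k) * s 0%N - (1 - k) * l)
             + (13 * (l * s 0%N) + l * (k * s 0%N)) by ring.
  have ls : 0 <= l * s 0%N by rewrite fmul_ge0.
  have k0 := idem_ge0 kk; rewrite -rsub_ge0 in h; have s0 := s_ge0 0.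
  by nonneg.
have W' := unstopped_transform n.+1; rewrite /= in W'.
have [h1 h2] := unstopped_le n; have [h3 h4] := unstopped_le n.+1.
rewrite /= in h3 h4.
have sS := square_le n; have dS := diff_le_square n; have W := unstopped_transform n.
have h5 : (1 - alive n.+1) * l <= (1 - alive n.+1) * (rabs (f n) + s n.+1).
  apply: dead_ge.
    rewrite -{1}(subrK (f n) (f n.+1)) addrC (le_trans (rabsD _ _)) // rleD2l.
    exact: dS.
  by rewrite -{1}[s n.+1]add0r rleD2r rabs_ge0.
have fd := rabs_mul_ge (f n) (f n.+1 - f n).
have ff := rabs_sqr (f n).
have s0 := s_ge0 n; have s0' := s_ge0 n.+1.
have A0 := rabs_ge0 (f n).
have rr := unstopped_idem n; have kk := alive_idem n.+1.
move: (unstopped n) (alive n.+1) (transform n) (f n) (f n.+1) (s n) (s n.+1)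
  (rabs (f n)) (rabs (f n.+1 - f n)) IH W' h1 h2 h3 h4 sS dS W h5 fd ff s0 s0' A0 rr kk.
move=> r k W g g' t t' a d IH W' h1 h2 h3 h4 sS dS Wr h5 gd gg t0 t0' a0 rr kk.
rewrite -rsub_ge0.
set G := _ - _.
have r0 := idem_ge0 rr; have k0 := idem_ge0 kk.
have r1 := idem_ge0 (idemC rr); have k1 := idem_ge0 (idemC kk).
rewrite -rsub_ge0 in IH; rewrite -rsub_ge0 in h2; rewrite -rsub_ge0 in h1.
rewrite -rsub_ge0 in h4; rewrite -rsub_ge0 in sS; rewrite -rsub_ge0 in dS.
rewrite -rsub_ge0 opprK in gd; rewrite -rsub_ge0 in h5.
(* The terms with factor [r - r * r] or [k - k * k] vanish. *)
have G1 : 0 <= (1 - r) * G.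
  have -> : (1 - r) * G = (1 - r) * (4 * W + 14 * (l * t) - l * l * (1 - r))
              + (1 - r) * (14 * (l * (t' - t)))
              + (r - r * r) * (8 * g * (g' - g) + l * l * (k - 1)) by rewrite /G; ring.
  by rewrite rr subrr mul0r addr0; nonneg.
have G2 : 0 <= r * k * G.
  have -> : r * k * G = 4 * (r * k * (W + 2 * (r * g) * (g' - g)))
      + (14 * (l * (r * k * t'))) - l * l * (r * k - r * k * (r * k)) by rewrite /G; ring.
  have -> : r * k * (r * k) = r * k by rewrite mulrACA rr kk.
  rewrite subrr mulr0 subr0 W'.
  have -> : 4 * (r * k * (g' * g' - t' * t')) + 14 * (l * (r * k * t'))
     = 4 * (r * k * (g' * g')) + 4 * (t' * (r * k * l - r * k * t'))
       + 10 * (l * (r * k * t')) by ring.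
  by nonneg.
have G3 : 0 <= r * (1 - k) * G.
  have -> : r * (1 - k) * G = (1 - k) * (4 * (r * W)) + r * (1 - k) *
     (8 * (g * (g' - g)) + 14 * (l * t') - l * l)
     - (r - r * r) * ((1 - k) * (8 * g * (g' - g)))
     + (k - k * k) * (r * (l * l) * r) by rewrite /G; ring.
  rewrite rr kk !subrr !mul0r subr0 addr0 Wr -gg.
  have -> : (1 - k) * (4 * (r * (a * a - t * t))) + r * (1 - k) * (8 * (g * (g' - g)) + 14 * (l * t') - l * l)
     = 4 * ((1 - k) * (t * (r * l - r * t))) + 4 * ((1 - k) * (r * (l * (t' - t))))
     + 8 * (r * (1 - k) * (g * (g' - g) + a * d)) + 8 * (r * (1 - k) * (a * (t' - d)))
     + 8 * (t' * ((1 - k) * (r * l - r * a)))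
     + 2 * (r * (l * ((1 - k) * (a + t') - (1 - k) * l)))
     + r * (1 - k) * ((a - l) * (a - l) + 3 * (a * a)) by ring.
  by nonneg.
have -> : G = (1 - r) * G + r * k * G + r * (1 - k) * G by ring.
by nonneg.
Qed.

End Pathwise.

(** * Martingales in the algebra *)

Section MartingaleCore.
Context {R : realType} {A : rieszSpaceType R} {mul : A -> A -> A} {one : A}.
Variable H : f_algebra mul one.
Notation U := (falg H).
Hypothesis dc : dedekind_complete U.
Hypothesis lat : laterally_complete U.
Variable I : set U.
Hypothesis idI : unital_ideal I.
Variable T : nat -> U -> U.
Hypothesis ceT : forall n, ideal_ce I (T n).
Hypothesis T_le : forall i j x, (i <= j)%N -> I x -> T j (T i x) = T i x.
Hypothesis T_ge : forall i j x, (i <= j)%N -> I x -> T i (T j x) = T i x.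
Variable f : nat -> U.
Hypothesis f_int : forall n, exists w, is_ce I (T 0%N) (rabs (f n)) w.
Hypothesis f_ce : forall i j v1 v2, (i <= j)%N ->
  is_ce I (T i) (rpos (f j)) v1 -> is_ce I (T i) (rneg (f j)) v2 -> f i = v1 - v2.
Implicit Types (u v w x y : U).

(** Integrability for [T 0] passes to [T i], without which the martingale identity
    would say nothing. *)
Lemma parts_ce i j : (i <= j)%N -> exists v1 v2,
  [/\ is_ce I (T i) (rpos (f j)) v1, is_ce I (T i) (rneg (f j)) v2 & f i = v1 - v2].
Proof.
move=> ij; have [w fw] := f_int j.
have ps v : 0 <= v -> v <= rabs (f j) -> exists v', is_ce I (T i) v v'.
  move=> v0 vf; have [w' vw'] := is_ce_dom dc idI v0 vf fw.
  by apply: (is_ce_tower dc idI (ceT 0) (ceT i)) vw' => // x Ix; exact: T_ge.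
have [v1 h1] : exists v', is_ce I (T i) (rpos (f j)) v'.
  by apply: ps; rewrite ?rpos_ge0 // rpos_le ?rabs_ge0 ?rabs_ge.
have [v2 h2] : exists v', is_ce I (T i) (rneg (f j)) v'.
  by apply: ps; rewrite ?rneg_ge0 // rneg_def rpos_le ?rabs_ge0 ?rabs_geN.
by exists v1, v2; split=> //; exact: f_ce h1 h2.
Qed.

Lemma measurable_mono i j u : (i <= j)%N -> measurable (T i) u -> measurable (T j) u.
Proof.
move=> ij mu x x0 h; apply: mu => // p [pp Tp] [Tpu [K K0 puK]]; apply: h.
  by split=> //; rewrite -Tp T_le //; exact: ideal_idem.
split; last by exists K.
by rewrite -[in LHS]Tpu T_le ?Tpu //; exact: ideal_bounded puK.
Qed.

Lemma measurable_martingale i j : (i <= j)%N -> measurable (T j) (f i).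
Proof.
move=> ij; apply: (measurable_mono ij).
have [v1 [v2 [h1 h2 ->]]] := parts_ce (leqnn i).
apply: (measurableB dc idI (ceT _)) => //.
- exact: (is_ce_measurable dc idI (ceT i) (rpos_ge0 _) h1).
- exact: (is_ce_measurable dc idI (ceT i) (rneg_ge0 _) h2).
Qed.

(** Vanishing of the extension of [T 0], which is defined on nonnegative elements
    only, at a signed element. *)
Definition mean_zero u := exists a b w,
  [/\ 0 <= a, 0 <= b, u = a - b, is_ce I (T 0%N) a w & is_ce I (T 0%N) b w].

Lemma mean_zero0 : mean_zero 0.
Proof.
have h : is_ce I (T 0%N) 0 (T 0%N 0) by apply: is_ce_self => //; exact: (ideal0 idI).
by exists 0, 0, (T 0%N 0); rewrite subr0.
Qed.

Lemma mean_zeroD u v : mean_zero u -> mean_zero v -> mean_zero (u + v).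
Proof.
move=> [a [b [w [a0 b0 -> aw bw]]]] [a' [b' [w' [a0' b0' -> aw' bw']]]].
exists (a + a'), (b + b'), (w + w'); split.
- exact: raddr_ge0.
- exact: raddr_ge0.
- by rewrite opprD addrACA.
- exact: is_ceD.
- exact: is_ceD.
Qed.

Lemma mean_zeroN u : mean_zero u -> mean_zero (- u).
Proof. by move=> [a [b [w [a0 b0 -> aw bw]]]]; exists b, a, w; rewrite opprB. Qed.

Lemma mean_zero_diff_ge0 n y : 0 <= y -> fixed_bounded (T n) y ->
  mean_zero (y * (f n.+1 - f n)).
Proof.
move=> y0 Hy; have [v1 [v2 [h1 h2 fE]]] := parts_ce (leqnSn n).
have v10 := is_ce_ge0 idI (ceT n) (rpos_ge0 _) h1.
have v20 := is_ce_ge0 idI (ceT n) (rneg_ge0 _) h2.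
have [w fw] := f_int n.+1; have [_ [K K0 yK]] := Hy.
have y1 : y <= K *: (1 : U) by rewrite (le_trans (rabs_ge y)).
have ex a : 0 <= a -> a <= rabs (f n.+1) -> exists w', is_ce I (T 0%N) (y * a) w'.
  move=> a0 af; apply: (is_ce_dom dc idI _ _ (is_ceZ idI (ceT 0) K0 fw)).
    exact: fmul_ge0.
  by rewrite (fscaleE K) fmul_le.
have tw x : I x -> T 0%N (T n x) = T 0%N x by move=> Ix; exact: T_ge.
have [w1 k1] : exists w', is_ce I (T 0%N) (y * rpos (f n.+1)) w'.
  by apply: ex; rewrite ?rpos_ge0 // rpos_le ?rabs_ge0 ?rabs_ge.
have [w2 k2] : exists w', is_ce I (T 0%N) (y * rneg (f n.+1)) w'.
  by apply: ex; rewrite ?rneg_ge0 // rneg_def rpos_le ?rabs_ge0 ?rabs_geN.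
have k1' := is_ce_tower_mul dc idI (ceT 0) (ceT n) tw y0 Hy (rpos_ge0 _) h1 k1.
have k2' := is_ce_tower_mul dc idI (ceT 0) (ceT n) tw y0 Hy (rneg_ge0 _) h2 k2.
exists (y * rpos (f n.+1) + y * v2), (y * rneg (f n.+1) + y * v1), (w1 + w2).
split.
- by rewrite raddr_ge0 ?fmul_ge0 ?rpos_ge0.
- by rewrite raddr_ge0 ?fmul_ge0 ?rneg_ge0.
- by rewrite fE -{1}(rposE (f n.+1)); ring.
- by apply: is_ceD => //; rewrite fmul_ge0 ?rpos_ge0.
- by rewrite addrC; apply: is_ceD => //; rewrite fmul_ge0 ?rneg_ge0.
Qed.

Lemma mean_zero_diff n y : fixed_bounded (T n) y -> mean_zero (y * (f n.+1 - f n)).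
Proof.
move=> Hy; rewrite -[y]rposE mulrBl; apply: mean_zeroD.
  by apply: mean_zero_diff_ge0; [exact: rpos_ge0 | exact: (fixed_bounded_pos idI (ceT n))].
apply: mean_zeroN; apply: mean_zero_diff_ge0; first exact: rneg_ge0.
exact: (fixed_bounded_pos idI (ceT n) (fixed_boundedN idI (ceT n) Hy)).
Qed.

Variables (s : nat -> U) (lambda : R).
Hypothesis s_ge0 : forall n, 0 <= s n.
Hypothesis s_0 : s 0%N * s 0%N = f 0%N * f 0%N.
Hypothesis s_S : forall n,
  s n.+1 * s n.+1 = s n * s n + (f n.+1 - f n) * (f n.+1 - f n).
Hypothesis lambda_gt0 : 0 < lambda.

Let r n := unstopped f s lambda n.
Let W n := transform f s lambda n.
Let l : U := lambda *: (1 : U).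

Lemma measurable_square i j : (i <= j)%N -> measurable (T j) (s i * s i).
Proof.
elim: i => [|i IH] ij; first by rewrite s_0; apply: (measurableM dc idI (ceT _)) => //; exact: measurable_martingale.
have m : measurable (T j) (f i.+1 - f i).
  by apply: (measurableB dc idI (ceT _)) => //; apply: measurable_martingale => //; exact: ltnW.
by rewrite s_S; apply: (measurableD dc idI (ceT _)) => //; [apply/IH/ltnW | exact: (measurableM dc idI (ceT _))].
Qed.

Lemma measurable_unstopped i j : (i <= j)%N -> measurable (T j) (r i).
Proof.
have ml : measurable (T j) l by exact: (measurableZ1 idI (ceT j)).
have m1 : measurable (T j) 1 by exact: (measurable1 (ceT j)).
have ma k : (k <= j)%N -> measurable (T j) (alive f s lambda k).
  move=> kj; have mi u : measurable (T j) u -> measurable (T j) (1 - ind u).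
    by move=> mu; apply: (measurableB dc idI (ceT _)) => //; exact: (measurable_ind dc idI (ceT _)).
  apply: (measurableM dc idI (ceT _)) => //; apply: mi; apply: (measurableB dc idI (ceT _)) => //.
  - by apply: (measurable_abs dc idI (ceT _)) => //; exact: measurable_martingale.
  - exact: measurable_square.
  - exact: (measurableM dc idI (ceT _)).
elim: i => [|i IH] ij; first exact: ma.
by apply: (measurableM dc idI (ceT _)) => //; [apply/IH/ltnW | exact: ma].
Qed.

Lemma mean_zero_transform n : mean_zero (W n).
Proof.
elim: n => [|n IH]; first exact: mean_zero0.
have rr : r n * r n = r n by exact: unstopped_idem.
have r0 := idem_ge0 rr.
have Hy : fixed_bounded (T n) (r n * f n).
  apply: (measurable_bounded dc idI (ceT n) (ltW lambda_gt0)).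
    rewrite (le_trans (rabs_mul_le _ _)) // (rabs_id r0).
    rewrite (le_trans (unstopped_le dc f s_ge0 lambda_gt0 n).1) //.
    by rewrite -[X in _ <= X]mul1r fmul_le2r ?idem_le1 ?riesz_scale_ge0 ?fone_ge0 ?ltW.
  by apply: (measurableM dc idI (ceT _)) => //; [exact: measurable_unstopped | exact: measurable_martingale].
have := mean_zero_diff Hy.
rewrite -[W n.+1]/(W n + 2 * (r n * f n) * (f n.+1 - f n)) => h.
apply: mean_zeroD => //.
have -> : 2 * (r n * f n) * (f n.+1 - f n)
   = r n * f n * (f n.+1 - f n) + r n * f n * (f n.+1 - f n) by ring.
exact: mean_zeroD.
Qed.

Lemma square_int n : exists w, is_ce I (T 0%N) (s n) w.
Proof.
elim: n => [|n [w sw]]; first by rewrite (square0 dc s_ge0 s_0); exact: f_int.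
have [w1 fw1] := f_int n; have [w2 fw2] := f_int n.+1.
have h := is_ceD idI (ceT 0) (rabs_ge0 _) (rabs_ge0 _) fw2 fw1.
have r0 : 0 <= rabs (f n.+1) + rabs (f n) by rewrite raddr_ge0 ?rabs_ge0.
apply: (is_ce_dom dc idI _ _ (is_ceD idI (ceT 0) (s_ge0 n) r0 sw h)) => //.
apply: le_trans (square_le_diff dc s_ge0 s_S n) _; rewrite rleD2l.
by rewrite -[rabs (f n)]rabsN rabsD.
Qed.

(** Applying [T 0] to the pathwise bound removes the transform, which is
    [a - b] with [a] and [b] of equal expectation. *)
Lemma weak_type_square n w : is_ce I (T 0%N) (s n) w ->
  lambda *: T 0%N (1 - r n) <= 14%:R *: w.
Proof.
move=> sw; have [a [b [w0 [a0 b0 Wab aw bw]]]] := mean_zero_transform n.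
have := pathwise_bound dc s_ge0 s_0 s_S lambda_gt0 n.
rewrite -/(r n) -/(W n) Wab -/l.
have rr : r n * r n = r n by exact: unstopped_idem.
have qI : I (1 - r n) by apply: (ideal_idem idI); exact: idemC.
have q0 : 0 <= 1 - r n by apply/idem_ge0/idemC.
have ll : l * l * (1 - r n) = (lambda * lambda) *: (1 - r n).
  by rewrite -mulrA /l -!fscaleE scalerA.
have -> : 4 * (a - b) = (4%:R : R) *: a - (4%:R : R) *: b.
  by rewrite mulrBr !scaler_nat !mulr_natl.
have -> : 14 * (l * s n) = (14%:R * lambda) *: s n.
  by rewrite /l -scalerA -fscaleE scaler_nat mulr_natl.
rewrite ll addrAC rle_subr => h.
have ll0 : 0 < lambda * lambda by rewrite mulr_gt0.
have p4 : (0 : R) < 4%:R by rewrite ltr0n.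
have p14 : (0 : R) < 14%:R * lambda by rewrite mulr_gt0 ?ltr0n.
have c1 := is_ceZ idI (ceT 0) ll0 (is_ce_self idI (ceT 0) qI q0).
have c2 := is_ceZ idI (ceT 0) p4 bw.
have c3 := is_ceZ idI (ceT 0) p4 aw.
have c4 := is_ceZ idI (ceT 0) p14 sw.
have q1 : 0 <= (lambda * lambda) *: (1 - r n) by apply: riesz_scale_ge0 => //; exact: ltW.
have q2 : 0 <= (4%:R : R) *: b by apply: riesz_scale_ge0 => //; exact: ltW.
have q3 : 0 <= (4%:R : R) *: a by apply: riesz_scale_ge0 => //; exact: ltW.
have q4 : 0 <= (14%:R * lambda) *: s n by apply: riesz_scale_ge0 => //; exact: ltW.
have L := is_ceD idI (ceT 0) q1 q2 c1 c2; have Rr := is_ceD idI (ceT 0) q3 q4 c3 c4.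
have := is_ce_mono h L Rr; rewrite [X in _ <= X]addrC rleD2r.
by rewrite [14%:R * _]mulrC -!scalerA rscale_leP.
Qed.

End MartingaleCore.

(** * The embedding into the universal completion *)

Section Embedding.
Context {R : realType} {E Eu : rieszSpaceType R}.
Variable ju : E -> Eu.
Hypothesis dcE : dedekind_complete E.
Hypothesis uc : universal_completion ju.
Implicit Types (g h x y : E) (u v w z : Eu) (D : set E).

Lemma juP (a : R) x y : ju (a *: x + y) = a *: ju x + ju y.
Proof. by have := uc_linear uc a x y. Qed.

Lemma juD x y : ju (x + y) = ju x + ju y.
Proof. by have := juP 1 x y; rewrite !scale1r. Qed.

Lemma ju0 : ju 0 = 0.
Proof. by apply: (addrI (ju 0)); rewrite -juD !addr0. Qed.

Lemma juZ (a : R) x : ju (a *: x) = a *: ju x.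
Proof. by have := juP a x 0; rewrite ju0 !addr0. Qed.

Lemma juN x : ju (- x) = - ju x.
Proof. by rewrite -!scaleN1r juZ. Qed.

Lemma juB x y : ju (x - y) = ju x - ju y.
Proof. by rewrite juD juN. Qed.

Lemma ju_le x y : (ju x <= ju y) = (x <= y).
Proof.
have jle (F : rieszSpaceType R) (a b : F) : (a <= b) = (rjoin a b == b).
  apply/idP/eqP => [ab|<-]; last exact: rjoin_lel.
  by apply/le_anti; rewrite rjoin_ler rjoin_le ab lexx.
by rewrite !jle -(uc_join uc) (inj_eq (uc_inj uc)).
Qed.

Lemma ju_ge0 x : (0 <= ju x) = (0 <= x).
Proof. by rewrite -ju_le ju0. Qed.

Lemma ju_pos x : ju (rpos x) = rpos (ju x).
Proof. by rewrite /rpos (uc_join uc) ju0. Qed.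

Lemma ju_abs x : ju (rabs x) = rabs (ju x).
Proof. by rewrite /rabs (uc_join uc) juN. Qed.

Lemma ju_meet x y : ju (rmeet x y) = rmeet (ju x) (ju y).
Proof. by rewrite !rmeetE juB ju_pos juB. Qed.

(** Order density makes the embedding preserve suprema: a bound [z] that fails to
    dominate [ju s] leaves room below [(ju s - z)^+] for some [ju g] with [g > 0],
    and [s - g] would be a smaller bound. *)
Lemma ju_sup D s : supremums D s -> supremums (ju @` D) (ju s).
Proof.
move=> [us ls]; split=> [_ [x Dx <-]|z uz]; first by rewrite ju_le us.
apply: contrapT => nz.
have [|g g0 gz] := uc_order_dense uc (u := rpos (ju s - z)).
  rewrite lt_neqAle rpos_ge0 andbT eq_sym; apply/eqP => /rpos_eq0.
  by rewrite rle_subl add0r.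
have : s <= s - g.
  apply: ls => x Dx; rewrite rle_subr addrC -rle_subr -ju_le juB.
  rewrite (le_trans gz) // rpos_le ?rsub_ge0 ?ju_le ?us // rleD2l rleN2.
  by apply: uz; exists x.
rewrite rle_subr -{2}[s]addr0 rleD2l => /(lt_le_trans g0).
by rewrite ltxx.
Qed.

Lemma ju_sup_inv D s : supremums (ju @` D) (ju s) -> supremums D s.
Proof.
move=> [us ls]; split=> [x Dx|z uz]; first by rewrite -ju_le us //; exists x.
by rewrite -ju_le; apply: ls => _ [x Dx <-]; rewrite ju_le uz.
Qed.

Definition minorants u : set E := [set g | 0 <= g /\ ju g <= u].

(** If [z < u] bounded the minorants and [0 < ju g <= u - z], then adding [g] to a
    minorant would give a minorant, so all multiples of [g] would be minorants. *)
Lemma minorants_dense u : 0 <= u -> supremums (ju @` minorants u) u.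
Proof.
move=> u0; split=> [_ [g [_ gu] <-] //|z uz]; apply: contrapT => nz.
pose z' := rmeet z u; have z'u : z' <= u := rmeet_ler _ _.
have [|g g0 gz] := uc_order_dense uc (u := u - z').
  rewrite lt_neqAle rsub_ge0 z'u andbT eq_sym subr_eq0; apply/eqP => e.
  by apply: nz; rewrite e rmeet_lel.
have gn n : ju (g *+ n) <= u.
  have gn0 n' : 0 <= g *+ n' by apply/rmuln_ge0/ltW.
  elim: n => [|n IH]; first by rewrite mulr0n ju0.
  have : ju (g *+ n) <= z'.
    by rewrite rmeet_ge IH andbT uz //; exists (g *+ n).
  by move=> h; rewrite mulrS juD (le_trans (rleD gz h)) // subrK.
have : ju g <= 0.
  apply: (archimedean (y := u)); first exact: (uc_dedekind uc).
  by move=> n; have := gn n; rewrite -scaler_nat juZ scaler_nat.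
by rewrite -ju0 ju_le => /(lt_le_trans g0); rewrite ltxx.
Qed.

Lemma minorants0 u : 0 <= u -> minorants u 0.
Proof. by split; rewrite ?ju0. Qed.

Lemma range_ju_le u y : 0 <= u -> u <= ju y -> range ju u.
Proof.
move=> u0 uy; have [||s Ds] := dcE (A := minorants u).
- by exists 0; exact: minorants0.
- by exists y => g [_ gu]; rewrite -ju_le (le_trans gu).
exists s => //; exact: sup_uniq (ju_sup Ds) (minorants_dense u0).
Qed.

Definition jinv u : E := xget 0 [set g | ju g = u].

Lemma ju_jinv u : range ju u -> ju (jinv u) = u.
Proof. move=> [g _ gu]; exact: (xgetPex 0 (ex_intro (fun x => ju x = u) g gu)). Qed.

Lemma jinv_ju g : jinv (ju g) = g.
Proof. by apply: (uc_inj uc); apply: ju_jinv; exists g. Qed.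

(** The right-hand side does not mention the completion. Since [cut_js] has the same
    one for the sup-completion, inequalities [ju h <= w] and [js h <= x] can be
    exchanged when [w] and [x] are suprema of the same subset of [E]. *)
Lemma cut_ju D w h : supremums (ju @` D) w ->
  ju h <= w <-> supremums [set rmeet h a | a in D] h.
Proof.
move=> Dw; have hw := sup_meet (ju h) Dw.
have e : [set rmeet (ju h) a | a in ju @` D] = ju @` [set rmeet h a | a in D].
  apply/seteqP; split=> [_ [_ [a Da <-] <-]|_ [_ [a Da <-] <-]].
    by exists (rmeet h a); [exists a | rewrite ju_meet].
  by exists (ju a); [exists a | rewrite ju_meet].
rewrite e in hw; split=> [hle|/ju_sup h'].
  by apply: ju_sup_inv; rewrite (rmeet_l hle) in hw.
by rewrite (sup_uniq h' hw) rmeet_ler.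
Qed.

Section Lift.
Variables (e : E) (mul : Eu -> Eu -> Eu).
Hypothesis H : f_algebra mul (ju e).
Notation U := (falg H).

Lemma ju_ideal : unital_ideal (range ju : set U).
Proof.
have lin : linear_subspace (range ju : set U).
  split; first by exists 0; rewrite ?ju0.
  by move=> a _ _ [x _ <-] [y _ <-]; exists (a *: x + y); rewrite // juP.
split=> //.
move=> x _ [y _ <-] xy; rewrite -[x]rposE.
have h u : 0 <= u -> u <= rabs x -> range ju u.
  by move=> u0 ux; apply: (range_ju_le (y := rabs y)) => //; rewrite ju_abs (le_trans ux).
have [g1 _ e1] : range ju (rpos x).
  by apply: h; rewrite ?rpos_ge0 // rpos_le ?rabs_ge0 ?rabs_ge.
have [g2 _ e2] : range ju (rneg x).
  by apply: h; rewrite ?rneg_ge0 // rneg_def rpos_le ?rabs_ge0 ?rabs_geN.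
by exists (g1 - g2) => //; rewrite juB e1 e2.
Qed.

Variable S : E -> E.
Hypothesis ce : conditional_expectation e S.

Lemma ceD x y : S (x + y) = S x + S y.
Proof. by have := ce_linear ce 1 x y; rewrite !scale1r. Qed.

Lemma ce0 : S 0 = 0.
Proof. by apply: (addrI (S 0)); rewrite -ceD !addr0. Qed.

Lemma ceZ (a : R) x : S (a *: x) = a *: S x.
Proof. by have := ce_linear ce a x 0; rewrite ce0 !addr0. Qed.

Lemma ceB x y : S (x - y) = S x - S y.
Proof. by rewrite ceD -!scaleN1r ceZ. Qed.

Lemma ce_ge0 x : 0 <= x -> 0 <= S x.
Proof.
rewrite le_eqVlt => /orP[/eqP <-|/(ce_strictly_positive ce)/ltW //].
by rewrite ce0.
Qed.

Lemma ce_le x y : x <= y -> S x <= S y.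
Proof. by move=> xy; rewrite -rsub_ge0 -ceB ce_ge0 // rsub_ge0. Qed.

(** Order continuity is about nets; the set [D], indexed by its own elements, is
    one. *)
Lemma ce_sup_directed D s : updirected D -> supremums D s -> supremums (S @` D) (S s).
Proof.
move=> [[d0 Dd0] Dd] [us ls]; split=> [_ [x Dx <-]|z uz]; first by rewrite ce_le ?us.
pose J := {x : E | D x}; pose leJ (i j : J) := sval i <= sval j.
have dirJ : directed leJ.
  split.
  - by constructor; exists d0.
  - by move=> i; exact: lexx.
  - by move=> i j k; exact: le_trans.
  - move=> [x Dx] [y Dy]; have [t Dt [xt yt]] := Dd _ _ Dx Dy.
    by exists (exist _ t Dt).
have cv : order_cvg leJ (fun i : J => sval i) s.
  exists (fun i : J => s - sval i); split.
  - by move=> i j ij; rewrite rleD2l rleN2.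
  - split=> [_ [[x Dx] _ <-]|t lt /=]; first by rewrite rsub_ge0 us.
    suff : s <= s - t by rewrite rle_subr -{2}[s]addr0 rleD2l.
    apply: ls => x Dx; rewrite rle_subr addrC -rle_subr.
    by apply: lt; exists (exist _ x Dx).
  - by move=> [x Dx] /=; rewrite -rabsN opprB rabs_id // rsub_ge0 us.
have [y [_ [_ ly] Sy]] := ce_order_continuous ce dirJ cv.
suff : S s - z <= 0 by rewrite rle_subl add0r.
apply: ly => _ [[x Dx] _ <-]; apply: le_trans (Sy (exist _ x Dx)) => /=.
rewrite -rabsN opprB (le_trans _ (rabs_ge _)) // rleD2l rleN2.
by apply: uz; exists x.
Qed.

Definition lift : U -> U := fun u => ju (S (jinv u)).

Lemma lift_ju g : lift (ju g) = ju (S g).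
Proof. by rewrite /lift jinv_ju. Qed.

Lemma lift_ce : ideal_ce (range ju : set U) lift.
Proof.
split.
- by move=> _ [x _ <-]; exists (S x); rewrite ?lift_ju.
- move=> a _ _ [x _ <-] [y _ <-].
  by rewrite !lift_ju -!juP lift_ju (ce_linear ce).
- by move=> _ [x _ <-]; rewrite lift_ju !ju_ge0; exact: ce_ge0.
- move=> _ [x _ <-]; rewrite lift_ju ju_ge0 => x0 Sx.
  apply: contrapT => nx; have : 0 < x.
    by rewrite lt_neqAle x0 andbT eq_sym; apply/eqP => x'; apply: nx; rewrite x' ju0.
  by move=> /(ce_strictly_positive ce); rewrite lt_neqAle -ju_le -(inj_eq (uc_inj uc)) Sx ju0 eqxx.
- move=> D _ DI Dd [s _ <-] Ds; pose D' := [set x | D (ju x)].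
  have DE : D = ju @` D'.
    apply/seteqP; split=> [u Du|_ [x Dx <-] //].
    by have [x _ xu] := DI _ Du; exists x => //; rewrite /D' /= xu.
  have Ds' : supremums D' s by apply: ju_sup_inv; rewrite -DE.
  have Dd' : updirected D'.
    split; first by have [[u Du] _] := Dd; have [x _ xu] := DI _ Du; exists x; rewrite /D' /= xu.
    move=> x y Dx Dy; have [t Dt] := Dd.2 _ _ Dx Dy; have [t' _ tE] := DI _ Dt.
    by rewrite -tE !ju_le => ?; exists t' => //; rewrite /D' /= tE.
  have := ju_sup (ce_sup_directed Dd' Ds'); rewrite lift_ju; congr (supremums _ _).
  rewrite DE; apply/seteqP; split=> [_ [_ [x Dx <-] <-]|_ [_ [x Dx <-] <-]].
    by exists (ju x); [exists x | rewrite lift_ju].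
  by exists (S x); [exists x | rewrite lift_ju].
- by move=> _ [x _ <-]; rewrite !lift_ju (ce_projection ce).
- move=> _ _ [x _ <-] [y _ <-]; rewrite !lift_ju => /(uc_inj uc) Sx /(uc_inj uc) Sy.
  have -> : rjoin (ju x : U) (ju y : U) = ju (rjoin x y) by rewrite (uc_join uc).
  rewrite lift_ju; congr ju.
  have [_ rj] := ce_range_subspace ce.
  have [||t _ <-] := rj x y; [by exists x | by exists y |].
  exact: (ce_projection ce).
- by rewrite -[1]/(ju e) lift_ju (ce_unit ce).
Qed.

Lemma lower_range v : lower (range ju : set U) v = ju @` minorants v.
Proof.
apply/seteqP; split=> [_ [[g _ <-] g0 gv]|_ [g [g0 gv] <-]].
  by exists g => //; split=> //; rewrite -ju_ge0.
by split; [exists g | rewrite ju_ge0 |].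
Qed.

Lemma is_ce_liftE (v w : U) : is_ce (range ju : set U) lift v w <->
  supremums (ju @` (S @` minorants v)) w.
Proof.
rewrite /is_ce lower_range; suff -> : lift @` (ju @` minorants v) = ju @` (S @` minorants v) by [].
apply/seteqP; split=> [_ [_ [x Dx <-] <-]|_ [_ [x Dx <-] <-]].
  by exists (S x); [exists x | rewrite lift_ju].
by exists (ju x); [exists x | rewrite lift_ju].
Qed.

End Lift.
End Embedding.

(** * The sup-completion *)

Section SupCompletionFacts.
Context {R : realType} {E Eu : rieszSpaceType R} {Es : orderedConeType R}.
Context {ju : E -> Eu} {js : E -> Es}.
Hypothesis uc : universal_completion ju.
Hypothesis sc : sup_completion js.
Implicit Types (g h : E) (u v w : Eu) (D : set E) (x y : Es).

Lemma es_sup (B : set Es) : B !=set0 -> supremums B (supremum cone_zero B).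
Proof.
move=> B0; have [t tE] := sc_top sc.
have [|s Bs] := sc_dedekind sc B0; first by exists t => y _; exact: tE.
by rewrite (supremumE _ B0 Bs).
Qed.

Lemma cut_js D x h : D !=set0 -> supremums (js @` D) x ->
  js h <= x <-> supremums [set rmeet h a | a in D] h.
Proof.
move=> D0 Dx; split=> [hx|/(sc_sup sc) [_]]; first exact: (sc_meet_sup sc D0 Dx hx).
apply=> _ [_ [a Da <-] <-]; apply: le_trans (Dx.1 _ (ex_intro2 _ _ a Da erefl)).
by rewrite (sc_le sc) rmeet_ler.
Qed.

Lemma minorants_sup u : 0 <= u -> supremums (js @` minorants ju u) (eu_to_es ju js u).
Proof. by move=> u0; apply: es_sup; exists (js 0), 0 => //; exact: minorants0. Qed.

Lemma js_le_es u h : 0 <= u -> js h <= eu_to_es ju js u <-> ju h <= u.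
Proof.
move=> u0; have D0 : minorants ju u !=set0 by exists 0; exact: minorants0.
rewrite (cut_js h D0 (minorants_sup u0)).
by rewrite (cut_ju uc h (minorants_dense uc u0)).
Qed.

Lemma eu_to_es_sup D u : D !=set0 -> (forall a, D a -> 0 <= a) ->
  supremums (ju @` D) u -> supremums (js @` D) (eu_to_es ju js u).
Proof.
move=> D0 Dge Du; have u0 : 0 <= u.
  have [a Da] := D0; apply: le_trans (Du.1 _ (ex_intro2 _ _ a Da erefl)).
  by rewrite (ju_ge0 uc) Dge.
split=> [_ [a Da <-]|z uz].
  by apply/js_le_es => //; apply: Du.1; exists a.
have Dx : supremums (js @` D) (supremum cone_zero (js @` D)).
  by apply: es_sup; have [a Da] := D0; exists (js a), a.
apply: le_trans (Dx.2 _ uz); apply: (minorants_sup u0).2 => _ [g [_ gu] <-].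
by apply/(cut_js g D0 Dx)/(cut_ju uc g Du).
Qed.

Lemma minorants_es u : 0 <= u -> below js (eu_to_es ju js u) = minorants ju u.
Proof.
move=> u0; apply/seteqP; split=> g [g0 gu]; split=> //; exact/js_le_es.
Qed.

Lemma eu_to_esK u : 0 <= u -> es_to_eu ju js (eu_to_es ju js u) = u.
Proof.
move=> u0; rewrite /es_to_eu; set Q := [set _ | _].
have [v0 e] : Q (xget 0 Q) by apply: (xgetPex 0 (ex_intro Q u _)).
apply: sup_uniq (minorants_dense uc v0) _.
rewrite -(minorants_es v0) e minorants_es //; exact: minorants_dense.
Qed.

Section CondExp.
Variables (e : E) (S : E -> E).
Hypothesis ce : conditional_expectation e S.

Lemma ce_minorants0 u : 0 <= u -> S @` minorants ju u !=set0.
Proof. by move=> u0; exists (S 0), 0 => //; exact: minorants0. Qed.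

Lemma ce_minorants_ge0 u a : (S @` minorants ju u) a -> 0 <= a.
Proof. by move=> [g [g0 _] <-]; exact: (ce_ge0 ce). Qed.

Lemma ce_sup_es u w : 0 <= u -> supremums (ju @` (S @` minorants ju u)) w ->
  ce_sup js S (eu_to_es ju js u) = eu_to_es ju js w.
Proof.
move=> u0 uw; rewrite /ce_sup minorants_es // -image_comp.
have D0 := ce_minorants0 u0; apply: supremumE.
  by have [a Da] := D0; exists (js a), a.
apply: eu_to_es_sup uw => //; exact: ce_minorants_ge0.
Qed.

Lemma ce_sup_es_inv u w : 0 <= u -> 0 <= w ->
  eu_to_es ju js w = ce_sup js S (eu_to_es ju js u) ->
  supremums (ju @` (S @` minorants ju u)) w.
Proof.
move=> u0 w0; rewrite /ce_sup minorants_es // -image_comp => wE.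
have D0 := ce_minorants0 u0.
have Dw : supremums (js @` (S @` minorants ju u)) (eu_to_es ju js w).
  by rewrite wE; apply: es_sup; have [a Da] := D0; exists (js a), a.
split=> [_ [a Da <-]|z uz]; first by apply/js_le_es => //; apply: Dw.1; exists a.
have z0 : 0 <= z.
  have [a Da] := D0; apply: le_trans (uz _ (ex_intro2 _ _ a Da erefl)).
  by rewrite (ju_ge0 uc) (ce_minorants_ge0 Da).
apply: (minorants_dense uc w0).2 => _ [g [g0 gw] <-]; apply/js_le_es => //.
apply: le_trans (_ : eu_to_es ju js w <= _); first exact/js_le_es.
apply: Dw.2 => _ [a Da <-]; apply/js_le_es => //; apply: uz; by exists a.
Qed.

End CondExp.
End SupCompletionFacts.

(** * The maximal inequality *)

Section Maximal.
Context {R : realType} {E : rieszSpaceType R} {Eu : rieszSpaceType R}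
        {Es : orderedConeType R}.
Variables (e : E) (T : nat -> E -> E) (ju : E -> Eu) (mul : Eu -> Eu -> Eu) (js : E -> Es).
Hypothesis dcE : dedekind_complete E.
Hypothesis filt : filtration e T.
Hypothesis uc : universal_completion ju.
Hypothesis H : f_algebra mul (ju e).
Hypothesis sc : sup_completion js.
Variable f : nat -> Eu.
Hypothesis mart : martingale ju js T f.
Variable lambda : R.
Hypothesis lambda_gt0 : 0 < lambda.
Notation U := (falg H).
Notation J := (range ju : set U).

Let dcU : dedekind_complete U := uc_dedekind uc.
Let ce n : conditional_expectation e (T n) := filt.1 n.
Let tT n : U -> U := lift (H := H) (T n).

Let s n : U := square_partial mul f n.
Let fU n : U := f n.

Lemma square_partialE n :
  0 <= s n /\ s n * s n = \sum_(k < n.+1) (mdiff f k : U) * (mdiff f k : U).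
Proof.
have sum0 : 0 <= \sum_(k < n.+1) (mdiff f k : U) * (mdiff f k : U).
  by elim/big_ind: _ => // [x y|k _]; [exact: raddr_ge0 | exact: fsqr_ge0].
have [v v0 vv] := sqrt_exists dcU sum0.
exact: (xgetPex 0 (ex_intro (fun v => 0 <= v /\ mul v v = _) v (conj v0 vv))).
Qed.

Lemma square_partial0 : s 0%N * s 0%N = fU 0%N * fU 0%N.
Proof. by have [_ ->] := square_partialE 0; rewrite big_ord1. Qed.

Lemma square_partialS n :
  s n.+1 * s n.+1 = s n * s n + (fU n.+1 - fU n) * (fU n.+1 - fU n).
Proof.
have [_ ->] := square_partialE n.+1; have [_ ->] := square_partialE n.
by rewrite big_ord_recr.
Qed.

Lemma ideal_ce_lift n : ideal_ce J (tT n).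
Proof. exact: (lift_ce uc H (ce n)). Qed.

Lemma lift_filtration_le i j x : (i <= j)%N -> J x -> tT j (tT i x) = tT i x.
Proof.
by move=> ij [g _ <-]; rewrite /tT !lift_ju //; have [-> _] := filt.2 j i g ij.
Qed.

Lemma lift_filtration_ge i j x : (i <= j)%N -> J x -> tT i (tT j x) = tT i x.
Proof.
by move=> ij [g _ <-]; rewrite /tT !lift_ju //; have [_ ->] := filt.2 j i g ij.
Qed.

Lemma martingale_integrable n : exists w, is_ce J (tT 0%N) (rabs (fU n)) w.
Proof.
have [v v0 vE] := mart_L1 mart n; exists v; apply/(is_ce_liftE uc).
exact: (ce_sup_es_inv uc sc (ce 0) (rabs_ge0 _) v0 vE).
Qed.

Lemma martingale_parts i j (v1 v2 : U) : (i <= j)%N ->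
  is_ce J (tT i) (rpos (fU j)) v1 -> is_ce J (tT i) (rneg (fU j)) v2 -> fU i = v1 - v2.
Proof.
move=> ij h1 h2; have idJ := ju_ideal dcE uc H; have cei := ideal_ce_lift i.
have v10 := is_ce_ge0 idJ cei (rpos_ge0 _) h1.
have v20 := is_ce_ge0 idJ cei (rneg_ge0 _) h2.
have := mart_ce mart ij; rewrite /ce_L1.
rewrite (ce_sup_es uc sc (ce i) (rpos_ge0 _) ((is_ce_liftE uc _ _ _).1 h1)).
rewrite (ce_sup_es uc sc (ce i) (rneg_ge0 _) ((is_ce_liftE uc _ _ _).1 h2)).
by rewrite !eu_to_esK // => <-.
Qed.

Let r n : U := unstopped fU s lambda n.

Lemma unstopped_ident n : r n * r n = r n.
Proof. exact: unstopped_idem. Qed.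

(** The exit event as an element of [E], increasing in [n]. *)
Definition stopped n : E := jinv ju (1 - r n).

Lemma ju_stopped n : ju (stopped n) = 1 - r n :> U.
Proof.
apply: ju_jinv; apply: (ideal_idem (ju_ideal dcE uc H)).
exact/idemC/unstopped_ident.
Qed.

Lemma stopped_bounds n : 0 <= stopped n /\ stopped n <= e.
Proof.
have pp := idemC (unstopped_ident n).
rewrite -(ju_ge0 uc) -(ju_le uc) ju_stopped; split; first exact: (idem_ge0 pp).
exact: (idem_le1 pp).
Qed.

Lemma stopped_mono m n : (m <= n)%N -> stopped m <= stopped n.
Proof.
move=> mn; rewrite -(ju_le uc) !ju_stopped.
change (1 - r m <= 1 - r n :> U); rewrite rleD2l rleN2.
elim: n mn => [|n IH]; first by rewrite leqn0 => /eqP ->.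
rewrite leq_eqVlt => /orP[/eqP -> //|/IH]; apply: le_trans.
rewrite -[r n.+1]/(r n * alive fU s lambda n.+1) -[X in _ <= X]mulr1.
apply: fmul_le2l; first exact: (idem_ge0 (unstopped_ident n)).
exact/idem_le1/alive_idem.
Qed.

Lemma stopped_sup : exists2 q, supremums (range stopped) q & updirected (range stopped).
Proof.
have [||q Dq] := dcE (A := range stopped).
- by exists (stopped 0), 0%N.
- by exists e => _ [n _ <-]; have [] := stopped_bounds n.
exists q => //; split; first by exists (stopped 0), 0%N.
move=> _ _ [m _ <-] [n _ <-]; exists (stopped (m + n)); first by exists (m + n)%N.
by rewrite !stopped_mono ?leq_addr ?leq_addl.
Qed.

(** [lambda T (stopped n) / 14] lies below the value of [T] at the [n]-th square
    function in the universal completion; the cut lemmas transport this to the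
    sup-completion, where that value is below [norm1] of the full square function. *)
Lemma stopped_weak_type n :
  js (lambda *: T 0%N (stopped n))
  <= cone_scale 14%:R (norm1 js (T 0%N) (square_function ju js mul f)).
Proof.
have idJ := ju_ideal dcE uc H.
have latU : laterally_complete U := uc_lateral uc.
have [w sw] := square_int dcU idJ ideal_ce_lift martingale_integrable
  (fun n => (square_partialE n).1) square_partial0 square_partialS n.
have := weak_type_square dcU latU idJ ideal_ce_lift lift_filtration_le
  lift_filtration_ge martingale_integrable martingale_parts
  (fun n => (square_partialE n).1) square_partial0 square_partialS lambda_gt0 sw.
rewrite -/(r n) -ju_stopped /tT lift_ju // => h.
have c0 : (0 : R) < 14%:R by rewrite ltr0n.
pose t := (14%:R : R)^-1 *: (lambda *: T 0%N (stopped n)).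
have tE : lambda *: T 0%N (stopped n) = (14%:R : R) *: t.
  by rewrite /t scalerA divff ?scale1r // gt_eqF.
rewrite tE (sc_scale sc) ?(ltW c0) //; apply: cone_le_scale; first exact: ltW.
have tw : ju t <= w.
  by rewrite /t (juZ uc) -(rscale_leP _ _ c0) scalerA divff ?gt_eqF // scale1r (juZ uc).
have s0 : 0 <= s n := (square_partialE n).1.
have D0 := ce_minorants0 (ju := ju) uc (T 0%N) s0.
have Dw : supremums (ju @` (T 0%N @` minorants ju (s n))) w by apply/(is_ce_liftE uc).
have Dx : supremums (js @` (T 0%N @` minorants ju (s n)))
            (supremum cone_zero (js @` (T 0%N @` minorants ju (s n)))).
  by apply: (es_sup sc); have [a Da] := D0; exists (js a), a.
have /(cut_js sc t D0 Dx) := (cut_ju uc t Dw).1 tw.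
move=> /le_trans; apply; apply: Dx.2 => _ [_ [g [g0 gs] <-] <-].
have sq g' : minorants ju (s n) g' -> below js (square_function ju js mul f) g'.
  move=> [g0' gs']; split=> //.
  apply: le_trans (_ : eu_to_es ju js (s n) <= _); first exact/(js_le_es uc sc).
  have := es_sup sc (B := range (fun n => eu_to_es ju js (square_partial mul f n))).
  by case=> [|us _]; [exists (eu_to_es ju js (s n)), n | apply: us; exists n].
have Nsup : supremums [set js (T 0%N g) | g in below js (square_function ju js mul f)]
     (norm1 js (T 0%N) (square_function ju js mul f)).
  by apply: (es_sup sc); exists (js (T 0%N 0)), 0 => //; apply/sq/(minorants0 uc).
by apply: Nsup.1; exists g => //; apply: sq.
Qed.

Lemma stopped_sup_weak_type q : supremums (range stopped) q -> updirected (range stopped) ->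
  js (lambda *: T 0%N q)
  <= cone_scale 14%:R (norm1 js (T 0%N) (square_function ju js mul f)).
Proof.
move=> Dq Dd; have := sc_sup sc (sup_scale lambda_gt0 (ce_sup_directed (ce 0) Dd Dq)).
by case=> _; apply=> _ [_ [_ [_ [n _ <-] <-] <-] <-]; exact: stopped_weak_type.
Qed.

Section Band.
Variable q : E.
Hypothesis Dq : supremums (range stopped) q.

Let c : U := 1 - (ju q : U).

Lemma stopped_limit_bounds : 0 <= q /\ q <= e.
Proof.
split; last by apply: Dq.2 => _ [n _ <-]; have [] := stopped_bounds n.
apply: le_trans (_ : stopped 0 <= _); first by have [] := stopped_bounds 0.
by apply: Dq.1; exists 0%N.
Qed.

Lemma never_stopped_ge0 : 0 <= c.
Proof. by rewrite rsub_ge0; have := stopped_limit_bounds.2; rewrite -(ju_le uc). Qed.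

Lemma never_stopped_le n : c <= r n.
Proof.
have : ju (stopped n) <= ju q by rewrite (ju_le uc); apply: Dq.1; exists n.
rewrite ju_stopped => h; rewrite /c rle_subl addrC -rle_subl.
exact: h.
Qed.

(** The disjoint complement of [c], the part of the unit that is never stopped. *)
Definition null_band : set E := [set x | c * (ju x : U) = 0].

Lemma null_band_band : band null_band.
Proof.
have c0 := never_stopped_ge0; split.
- split; first by rewrite /null_band /= (ju0 uc) mulr0.
  move=> a x y xn yn; rewrite /null_band /= (juP uc).
  rewrite mulrDr [X in _ + X]yn addr0 mulrC -fscaleAl mulrC.
  by rewrite [X in _ *: X]xn scaler0.
- move=> x y yn xy.
  have cabs (z : U) : c * rabs z = rabs (c * z).
    rewrite !rabsE mulrDr !rneg_def -mulrN.
    by rewrite ![c * _]mulrC !rpos_mul.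
  apply: rabs0_eq; rewrite -cabs.
  apply: le_trans (_ : c * rabs (ju y : U) <= _); last first.
    rewrite cabs.
    have -> : c * (ju y : U) = 0 by exact: yn.
    by rewrite rabs_id.
  by apply: fmul_le2l => //; have := xy; rewrite -(ju_le uc) !(ju_abs uc).
- (* The last step is for [A] empty: then [a], and so [d], is below everything. *)
  move=> A a An Aa; have := sup_mul dcU c0 (ju_sup uc Aa : supremums (ju @` A : set U) (ju a : U)).
  set B := [set _ | _ in _] => Ba.
  have B0 b : B b -> b = 0 by move=> [_ [x Ax <-] <-]; exact: An.
  apply/le_anti/andP; split; first by apply: Ba.2 => b /B0 ->.
  have [[b Bb]|nB] := pselect (B !=set0); first by rewrite -(B0 b Bb); exact: Ba.1.
  set d := c * _ in Ba *; have : d <= d + d by apply: Ba.2 => b Bb; case: nB; exists b.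
  by rewrite -{1}[d]addr0 rleD2l.
Qed.

(** On [c] every [f n] satisfies [|f n| <= lambda]. *)
Lemma maximal_null h : below js (maximal_function ju js f) h ->
  c * (ju h : U) <= c * (lambda *: (1 : U)).
Proof.
have c0 := never_stopped_ge0; move=> [h0 hf].
pose A : set E := [set g | exists n, minorants ju (rabs (f n)) g].
have A0 : A !=set0 by exists 0, 0%N; apply: (minorants0 uc); exact: rabs_ge0.
have As : supremums (js @` A) (maximal_function ju js f).
  have := es_sup sc (B := range (fun n => eu_to_es ju js (rabs (f n)))).
  case=> [|um lm]; first by exists (eu_to_es ju js (rabs (f 0%N))), 0%N.
  split=> [_ [g [n gn] <-]|z uz].
    apply: le_trans (um _ (ex_intro2 _ _ n I erefl)).
    by apply/(js_le_es uc sc) => //; [exact: rabs_ge0 | have [] := gn].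
  apply: lm => _ [n _ <-]; apply: (minorants_sup uc sc (rabs_ge0 (f n))).2.
  by move=> _ [g gn <-]; apply: uz; exists g => //; exists n.
have hs := (cut_js sc h A0 As).1 hf.
apply: (sup_mul dcU c0 (ju_sup uc hs : supremums (_ : set U) (ju h : U))).2.
move=> _ [_ [_ [g [n [g0 gn]] <-] <-] <-].
apply: (le_trans (y := c * rabs (fU n))).
  apply: fmul_le2l => //; apply: le_trans gn.
  by rewrite (ju_le uc) rmeet_ler.
have l0 : 0 <= lambda *: (1 : U) by apply: riesz_scale_ge0; [exact: ltW | exact: fone_ge0].
have := (unstopped_le dcU fU (fun n => (square_partialE n).1) lambda_gt0 n).1.
rewrite -/(r n) -[X in _ <= X]add0r -rle_subl -mulrBr => rf.
have r0 : 0 <= r n := idem_ge0 (unstopped_ident n).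
set t := rabs (fU n) - lambda *: (1 : U) in rf.
have rt : r n * rpos t = 0.
  by rewrite mulrC -rpos_mul // mulrC; apply/rpos_eq0.
have ct : c * rpos t = 0.
  apply/le_anti; rewrite fmul_ge0 ?rpos_ge0 // andbT -rt.
  by apply: fmul_le2r; [exact: rpos_ge0 | exact: never_stopped_le].
rewrite -[X in _ <= X]add0r -rle_subl -mulrBr -/t -ct.
by apply: fmul_le2l => //; exact: rpos_ge.
Qed.

Lemma excess_null : below js (excess js e lambda (maximal_function ju js f)) `<=` null_band.
Proof.
have c0 := never_stopped_ge0.
move=> g [g0 gx]; set F := maximal_function ju js f in gx.
pose A : set E := [set rpos (h - lambda *: e) | h in below js F].
have AN : A `<=` null_band.
  move=> _ [h /maximal_null hF <-]; rewrite /null_band /=.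
  have -> : (ju (rpos (h - lambda *: e)) : U) = rpos ((ju h : U) - lambda *: (1 : U)).
    by rewrite (ju_pos uc) (juB uc) (juZ uc).
  by rewrite mulrC -rpos_mul // mulrC; apply/rpos_eq0; rewrite mulrBr rle_subl add0r.
have B0 : below js F 0.
  split=> //; apply: le_trans (_ : eu_to_es ju js (rabs (f 0%N)) <= _).
    by apply/(js_le_es uc sc); rewrite ?(ju0 uc); exact: rabs_ge0.
  have := es_sup sc (B := range (fun n => eu_to_es ju js (rabs (f n)))).
  by case=> [|u _]; [exists (eu_to_es ju js (rabs (f 0%N))), 0%N | apply: u; exists 0%N].
have A0 : A !=set0 by exists (rpos (0 - lambda *: e)), 0.
have As : supremums (js @` A) (excess js e lambda F).
  by rewrite /excess /A image_comp; apply: (es_sup sc); have [a Aa] := A0; exists (js a); rewrite -image_comp; exists a.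
have [_ nsolid nsup] := null_band_band.
apply: nsup ((cut_js sc g A0 As).1 gx) => _ [a Aa <-].
apply: (nsolid _ a); first exact: AN.
have a0 : 0 <= a by have [h _ <-] := Aa; exact: rpos_ge0.
by rewrite rabs_id ?rmeet_ge0 // rabs_id // rmeet_ler.
Qed.

(** The projection [Y] of [e] is disjoint from [e - Y], so it is an idempotent; it
    lies in [null_band], so [Y = Y * q <= q]. When no element has the defining
    property of the projection, its default value [0] satisfies the bound too. *)
Lemma band_proj_le :
  band_proj_sup js (excess js e lambda (maximal_function ju js f)) e <= q.
Proof.
have [q0 qe] := stopped_limit_bounds; rewrite /band_proj_sup /band_proj.
set B := band_gen _; set Q := [set _ | _].
have [[y0 Qy0]|nQ] := pselect (exists y, Q y); last first.
  by rewrite xgetPN // => y Qy; apply: nQ; exists y.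
have [By disj] : Q (xget 0 Q) by exact: (xgetPex 0 (ex_intro Q y0 Qy0)).
move: (xget 0 Q) By disj => y By disj.
have cy : c * (ju y : U) = 0 := By _ null_band_band excess_null.
pose Y : U := ju y.
have YY : Y * Y = Y.
  have d := disj y By.
  have : rmeet (rabs (1 - Y)) (rabs Y) = 0.
    have -> : 1 - Y = ju (e - y) :> U by rewrite (juB uc).
    by have := congr1 ju d; rewrite (ju_meet uc) !(ju_abs uc) (ju0 uc).
  move/(disj_mul0 (H := H) (rabs_ge0 _) (rabs_ge0 _)) => m0.
  have : (1 - Y) * Y = 0 by apply: rabs0_eq; rewrite -m0 rabs_mul_le.
  by rewrite mulrBl mul1r => /eqP; rewrite subr_eq0 => /eqP <-.
rewrite -(ju_le uc); change (Y <= (ju q : U)).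
have -> : Y = Y * (ju q : U).
  by apply/eqP; rewrite -subr_eq0 -{1}[Y]mulr1 -mulrBr mulrC; apply/eqP; exact: cy.
apply: (le_trans (y := 1 * (ju q : U))); last by rewrite mul1r.
apply: fmul_le2r; last exact: idem_le1.
by have := q0; rewrite -(ju_ge0 uc).
Qed.

End Band.
End Maximal.

Theorem theorem4p13 (R : realType) :
  exists2 C : R, 0 < C &
  forall (E : rieszSpaceType R) (e : E) (T : nat -> E -> E)
         (Eu : rieszSpaceType R) (ju : E -> Eu) (mul : Eu -> Eu -> Eu)
         (Es : orderedConeType R) (js : E -> Es),
    dedekind_complete E ->
    weak_order_unit e ->
    filtration e T ->
    universal_completion ju ->
    f_algebra mul (ju e) ->
    sup_completion js ->
    forall f : nat -> Eu,
      martingale ju js T f ->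
      L1_bounded ju js T f ->
      forall lambda : R, 0 < lambda ->
        js (lambda *: T 0%N
              (band_proj_sup js (excess js e lambda (maximal_function ju js f)) e))
        <= cone_scale C (norm1 js (T 0%N) (square_function ju js mul f)).
Proof.
exists 14%:R; first by rewrite ltr0n.
move=> E e T Eu ju mul Es js dcE _ filt uc H sc f mart _ lambda l0.
have [q Dq Dd] := stopped_sup dcE uc H f lambda.
apply: le_trans (stopped_sup_weak_type dcE filt uc sc mart l0 Dq Dd).
rewrite (sc_le sc); apply: rscale_le; first exact: ltW.
apply: (ce_le (filt.1 0)); exact: (band_proj_le dcE uc sc l0 Dq).
Qed.
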